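(* Fix a line $\ell\subset\mathbb{P}^2$. Let $E^{(4)}$ be the variety of holomorphic quadratic self-maps $f:\mathbb{P}^2\to\mathbb{P}^2$ with $f(\ell)\subset\ell$, all of whose fixed points are isolated and simple, together with a marking (ordering) $p_1,p_2,p_3,p_4$ of the four fixed points not lying on $\ell$. For $f\in E^{(4)}$ and $i=1,\dots,4$, let $t_i$ and $d_i$ be the trace and the determinant of $\mathbf{I}-Df|_{p_i}$ (as an endomorphism of $T_{p_i}\mathbb{P}^2$). Then the algebraic map $\Psi:E^{(4)}\to\mathbb{C}^8$, $f\mapsto (t_1,d_1,t_2,d_2,t_3,d_3,t_4,d_4)$, is dominant, and its generic fiber consists of exactly four orbits of the natural action (by conjugation) of the group $\operatorname{Aut}(\mathbb{P}^2,\ell)$ on $E^{(4)}$.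
   Context: A holomorphic quadratic self-map of $\mathbb{P}^2$ is a map $[z_1:z_2:z_3]\mapsto[P_1:P_2:P_3]$ with $P_1,P_2,P_3$ homogeneous quadratic polynomials without common zeros other than $0$. A fixed point $p$ is simple (non-degenerate) if $\det(\mathbf{I}-Df|_p)\neq 0$. Such a map preserving $\ell$ with isolated simple fixed points has exactly seven fixed points, three on $\ell$ and four off $\ell$. $\operatorname{Aut}(\mathbb{P}^2,\ell)$ is the subgroup of $\mathrm{PGL}(3,\mathbb{C})$ of automorphisms preserving $\ell$ (the affine transformations of $\mathbb{P}^2\setminus\ell\cong\mathbb{C}^2$); it acts on $E^{(4)}$ by $g\cdot f=g\circ f\circ g^{-1}$, transporting the marking. *)

(* Defs.v *)
From HB Require Import structures.
From mathcomp Require Import all_boot all_order all_algebra.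
Set Implicit Arguments.
Unset Strict Implicit.
Unset Printing Implicit Defensive.
Import GRing.Theory.
Local Open Scope ring_scope.

(* Homogeneous coordinates on P^2 are vectors z : 'I_3 -> F (nonzero, up to
   scalars).  A quadratic self-map [P_0:P_1:P_2] is given by coefficients
   Q m i j with P_m(z) = sum_{i,j} Q m i j z_i z_j. *)
Section Quad.
Variable F : fieldType.

Definition vec3 := 'I_3 -> F.
Definition quadmap := 'I_3 -> 'I_3 -> 'I_3 -> F.

Definition qeval (Q : quadmap) (z : vec3) : vec3 :=
  fun m => \sum_(i < 3) \sum_(j < 3) Q m i j * z i * z j.

Definition qderiv (Q : quadmap) (m l : 'I_3) (z : vec3) : F :=
  \sum_(j < 3) (Q m l j + Q m j l) * z j.

Definition nonzero (z : vec3) : Prop := exists i, z i != 0.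

Definition proj_eq (z w : vec3) : Prop :=
  exists c : F, c != 0 /\ forall i, w i = c * z i.

Definition lin (a z : vec3) : F := \sum_(i < 3) a i * z i.
Definition on_line (a z : vec3) : Prop := lin a z = 0.

Definition is_fixed (Q : quadmap) (z : vec3) : Prop :=
  nonzero z /\ exists c : F, forall i, qeval Q z i = c * z i.

Definition chart_index (z : vec3) : 'I_3 := odflt ord0 [pick k | z k != 0].

(* Jacobian matrix of f in the affine chart {z_k <> 0} (coordinates
   x_j = z_{lift k j} / z_k), at the point z, assuming z and f(z) lie in that
   chart (true at fixed points): entry (i,j) is d/dx_j (P_{lift k i}/P_k). *)
Definition chart_jac (Q : quadmap) (z : vec3) : 'M[F]_2 :=
  let k := chart_index z in
  let p := fun i => z i / z k in
  \matrix_(i < 2, j < 2)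
     ((qderiv Q (lift k i) (lift k j) p * qeval Q p k
       - qeval Q p (lift k i) * qderiv Q k (lift k j) p)
      / (qeval Q p k ^+ 2)).

Definition trI (Q : quadmap) (z : vec3) : F := \tr (1%:M - chart_jac Q z).
Definition detI (Q : quadmap) (z : vec3) : F := \det (1%:M - chart_jac Q z).

Definition simple_fixed (Q : quadmap) (z : vec3) : Prop := detI Q z != 0.

Definition holo (Q : quadmap) : Prop :=
  forall z, (forall m, qeval Q z m = 0) -> forall i, z i = 0.

Definition preserves_line (a : vec3) (Q : quadmap) : Prop :=
  forall z, on_line a z -> on_line a (qeval Q z).

(* fixed points isolated (= finitely many, the fixed locus being algebraic) *)
Definition fixed_isolated (Q : quadmap) : Prop :=
  exists (n : nat) (s : 'I_n -> vec3),
    forall z, is_fixed Q z -> exists i, proj_eq (s i) z.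

Definition fixed_simple (Q : quadmap) : Prop :=
  forall z, is_fixed Q z -> simple_fixed Q z.

Definition E4 (a : vec3) (Q : quadmap) (p : 'I_4 -> vec3) : Prop :=
  holo Q /\ preserves_line a Q /\ fixed_isolated Q /\ fixed_simple Q /\
  (forall i, is_fixed Q (p i) /\ ~ on_line a (p i)) /\
  (forall i j, proj_eq (p i) (p j) -> i = j) /\
  (forall z, is_fixed Q z -> ~ on_line a z -> exists i, proj_eq (p i) z).

Definition Psi (Q : quadmap) (p : 'I_4 -> vec3) : 'I_4 * bool -> F :=
  fun ib => if ib.2 then detI Q (p ib.1) else trI Q (p ib.1).

Definition mxapp (g : 'M[F]_3) (z : vec3) : vec3 :=
  fun i => \sum_(j < 3) g i j * z j.

Definition aut_line (a : vec3) (g : 'M[F]_3) : Prop :=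
  g \in unitmx /\ forall z, on_line a z -> on_line a (mxapp g z).

Definition same_map (f f' : vec3 -> vec3) : Prop :=
  forall z, nonzero z -> proj_eq (f z) (f' z).

Definition conj_rel (a : vec3) (Q : quadmap) (p : 'I_4 -> vec3)
    (Q' : quadmap) (p' : 'I_4 -> vec3) : Prop :=
  exists g : 'M[F]_3, aut_line a g /\
    same_map (fun z => mxapp g (qeval Q (mxapp (invmx g) z))) (qeval Q') /\
    forall i, proj_eq (mxapp g (p i)) (p' i).

End Quad.

Inductive polyfun (F : ringType) (I : Type) : ((I -> F) -> F) -> Prop :=
| pf_const (c : F) : polyfun (fun _ => c)
| pf_var (i : I) : polyfun (fun x => x i)
| pf_add f g : polyfun f -> polyfun g -> polyfun (fun x => f x + g x)
| pf_mul f g : polyfun f -> polyfun g -> polyfun (fun x => f x * g x).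

(* Main.v *)
Require Import Defs.
From HB Require Import structures.
From mathcomp Require Import all_boot all_order all_algebra.
From mathcomp Require Import ring.
From Stdlib Require Import FunctionalExtensionality.
Import GRing.Theory.
Local Open Scope ring_scope.

(* A fixed point p off the line satisfies L(p) c = L(p) M(p), where L o P = L M
   and P(p) = c p, so it is a zero of R := P - M z; no three of the four p_i are
   collinear, hence they may be taken to be e_0, e_1, e_2, (1,1,1).  The R_i then
   lie in the pencil of conics through these points, R is given by a 3x3 matrix A
   with zero row sums, and L spans the left kernel of A.  With M_i the value of
   M at p_i, the numbers T_i = -t_i M_i are linear and D_i = d_i M_i^2 quadratic
   in A, subject to T_3 = T_0 + T_1 + T_2 and D_3 = -(D_0 + D_1 + D_2).  These
   say that M lies on a line and on a conic: two solutions.  Given M, the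
   antisymmetric part (u_0, u_1, u_2) of A satisfies three bilinear equations,
   one for each pair of unknowns; u_0 is thus a fixed point of a composite of
   three Moebius maps: two solutions again.  Genericity is imposed at all four
   solutions at once by taking norms of polynomials along the two successive
   quadratic extensions, and is checked at one point v where they are rational. *)

Set Implicit Arguments.
Unset Strict Implicit.
Unset Printing Implicit Defensive.

(** * Vectors and the three-dimensional Jacobian *)

(** The marking makes the count rigid: a projectivity fixing the four standard points is scalar, so
    orbits of marked maps are normal forms (M, A) up to one common scalar, and no permutation of the
    points is divided out. The two relations come from comparing derivatives of R. At e_0, in the
    directions z_1, z_2, the derivative has entries A_{11}, A_{12}, A_{21}, A_{22}; at (1,1,1),
    because the row sums vanish, it is -A. Hence T_3 and D_3 are minus the trace and the sum of the
    principal minors of A, while T_i = 2 s_i and D_i is minus a principal minor for i < 3. The data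
    at the four points do not control the map on the line itself. There it restricts to a pair of
    binary quadratic forms (p : q), and both remaining demands of [E4], no base point and simple
    fixed points, become nonvanishing of resultants. Dominance is the existence of the four maps
    wherever H is nonzero. *)

Definition i0 : 'I_3 := @Ordinal 3 0 isT.
Definition i1 : 'I_3 := @Ordinal 3 1 isT.
Definition i2 : 'I_3 := @Ordinal 3 2 isT.

Lemma ord3P (P : 'I_3 -> Prop) : P i0 -> P i1 -> P i2 -> forall i, P i.
Proof.
move=> P0 P1 P2 [[|[|[|//]]] hi].
- by rewrite (_ : Ordinal hi = i0) //; apply: val_inj.
- by rewrite (_ : Ordinal hi = i1) //; apply: val_inj.
- by rewrite (_ : Ordinal hi = i2) //; apply: val_inj.
Qed.

Lemma sum3 (V : nmodType) (f : 'I_3 -> V) : \sum_(i < 3) f i = f i0 + f i1 + f i2.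
Proof.
rewrite !big_ord_recl big_ord0 addr0 addrA.
by congr (f _ + f _ + f _); apply: val_inj.
Qed.

Definition mk3 (T : Type) (x y z : T) : 'I_3 -> T :=
  fun i => match val i with 0%N => x | 1%N => y | _ => z end.
Arguments mk3 T x y z !i /.

Section Vectors.
Variable F : fieldType.
Implicit Types (z w a : vec3 F) (Q : quadmap F) (g h : 'M[F]_3).

Lemma vecP z w : z i0 = w i0 -> z i1 = w i1 -> z i2 = w i2 -> z = w.
Proof. by move=> *; apply: functional_extensionality; apply: ord3P. Qed.

Lemma vec_ext z w : (forall i, z i = w i) -> z = w.
Proof. exact: functional_extensionality. Qed.

Definition vscale (c : F) z : vec3 F := fun i => c * z i.
Definition vadd z w : vec3 F := fun i => z i + w i.
Definition unitv (l : 'I_3) : vec3 F := fun i => (i == l)%:R.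

Lemma det_mx22 (A : 'M[F]_2) : \det A = A 0 0 * A 1 1 - A 0 1 * A 1 0.
Proof.
rewrite (expand_det_row _ 0) !big_ord_recl big_ord0 /cofactor !det_mx11 !mxE /=.
rewrite (_ : lift 0 0 = 1 :> 'I_2); last exact: val_inj.
rewrite (_ : lift 1 0 = 0 :> 'I_2); last exact: val_inj.
by rewrite expr0 expr1; ring.
Qed.

Lemma det_mx33 (A : 'M[F]_3) : \det A =
    A i0 i0 * (A i1 i1 * A i2 i2 - A i1 i2 * A i2 i1)
  - A i0 i1 * (A i1 i0 * A i2 i2 - A i1 i2 * A i2 i0)
  + A i0 i2 * (A i1 i0 * A i2 i1 - A i1 i1 * A i2 i0).
Proof.
rewrite (expand_det_row _ i0) sum3 /cofactor !det_mx22 !mxE /=.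
have e00 : lift i0 (0 : 'I_2) = i1 by apply: val_inj.
have e01 : lift i0 (1 : 'I_2) = i2 by apply: val_inj.
have e10 : lift i1 (0 : 'I_2) = i0 by apply: val_inj.
have e11 : lift i1 (1 : 'I_2) = i2 by apply: val_inj.
have e20 : lift i2 (0 : 'I_2) = i0 by apply: val_inj.
have e21 : lift i2 (1 : 'I_2) = i1 by apply: val_inj.
by rewrite !(e00, e01, e10, e11, e20, e21) expr0 expr1 sqrrN expr1n; ring.
Qed.

Lemma mxapp_mul g h z : mxapp (g *m h) z = mxapp g (mxapp h z).
Proof. by apply: vecP; rewrite /mxapp !sum3 !mxE !sum3; ring. Qed.

Lemma mxapp1 z : mxapp 1%:M z = z.
Proof. by apply: vecP; rewrite /mxapp !sum3 !mxE /=; ring. Qed.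

Lemma mxappK g z : g \in unitmx -> mxapp (invmx g) (mxapp g z) = z.
Proof. by move=> ug; rewrite -mxapp_mul mulVmx // mxapp1. Qed.

Lemma mxappVK g z : g \in unitmx -> mxapp g (mxapp (invmx g) z) = z.
Proof. by move=> ug; rewrite -mxapp_mul mulmxV // mxapp1. Qed.

Lemma mxappZ g c z : mxapp g (vscale c z) = vscale c (mxapp g z).
Proof. by apply: vecP; rewrite /mxapp /vscale !sum3; ring. Qed.

Lemma mxappD g z w : mxapp g (vadd z w) = vadd (mxapp g z) (mxapp g w).
Proof. by apply: vecP; rewrite /mxapp /vadd !sum3; ring. Qed.

Lemma mxapp_unitv g l i : mxapp g (unitv l) i = g i l.
Proof. by move: l; apply: ord3P; rewrite /mxapp /unitv sum3 /=; ring. Qed.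

Lemma mx_ext g h : (forall z, mxapp g z = mxapp h z) -> g = h.
Proof. by move=> e; apply/matrixP=> i j; rewrite -!mxapp_unitv e. Qed.

Lemma qevalZ Q c z : qeval Q (vscale c z) = vscale (c ^+ 2) (qeval Q z).
Proof. by apply: vec_ext => m; rewrite /qeval /vscale !sum3; ring. Qed.

Definition jac Q z : 'M[F]_3 := \matrix_(m, l) qderiv Q m l z.

(** The polar form depends only on values of the map, so the conjugation rule for [jac] follows from
    the one for [qeval] without expanding coefficients. *)
Lemma jac_polar Q z w :
  vadd (qeval Q (vadd z w)) (vscale (-1) (vadd (qeval Q z) (qeval Q w)))
  = mxapp (jac Q z) w.
Proof.
apply: vec_ext => m.
by rewrite /mxapp /jac sum3 !mxE /qderiv /qeval /vadd /vscale !sum3; ring.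
Qed.

Lemma jac_euler Q z m : \sum_(l < 3) qderiv Q m l z * z l = qeval Q z m *+ 2.
Proof. by rewrite /qderiv /qeval !sum3; ring. Qed.

Lemma jacZ Q c z : jac Q (vscale c z) = c *: jac Q z.
Proof. by apply/matrixP=> m l; rewrite !mxE /qderiv /vscale !sum3; ring. Qed.

Lemma chart_indexP z : nonzero z -> z (chart_index z) != 0.
Proof.
move=> [i zi]; rewrite /chart_index; case: pickP => //= z0.
by rewrite z0 in zi.
Qed.

Lemma chart_jacE Q z c : nonzero z -> c != 0 -> (forall i, qeval Q z i = c * z i) ->
  let k := chart_index z in
  forall i j, chart_jac Q z i j =
   (qderiv Q (lift k i) (lift k j) z
    - z (lift k i) / z k * qderiv Q k (lift k j) z) / c.
Proof.
move=> nz c0 e k i j; rewrite /chart_jac mxE -/k.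
have zk : z k != 0 by apply: chart_indexP.
have -> : (fun i => z i / z k) = vscale (z k)^-1 z.
  by apply: vec_ext => l; rewrite /vscale mulrC.
have qd m l : qderiv Q m l (vscale (z k)^-1 z) = (z k)^-1 * qderiv Q m l z.
  by have /matrixP/(_ m l) := jacZ Q (z k)^-1 z; rewrite !mxE.
rewrite !qd qevalZ /vscale !e; field.
by rewrite zk c0.
Qed.
 
(* J/c acts as 2 on the line spanned by z (Euler) and as Df on the quotient. *)
Lemma trI_detI_jac Q z c : nonzero z -> c != 0 -> (forall i, qeval Q z i = c * z i) ->
  trI Q z = 4%:R - \tr (jac Q z) / c /\
  detI Q z = - \det (1%:M - c^-1 *: jac Q z).
Proof.
move=> nz c0 e; rewrite /trI /detI det_mx33 det_mx22 /mxtrace sum3.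
rewrite !big_ord_recl big_ord0.
rewrite (_ : lift ord0 ord0 = 1 :> 'I_2); last exact: val_inj.
have := chart_jacE nz c0 e; have := chart_indexP nz.
move: (chart_index z) (chart_jac Q z) => k C zk /= cj; rewrite !mxE !cj.
have eu m := jac_euler Q z m.
have := eu i0; have := eu i1; have := eu i2; rewrite !sum3 !e {eu}.
have e00 : lift i0 (0 : 'I_2) = i1 by apply: val_inj.
have e01 : lift i0 (1 : 'I_2) = i2 by apply: val_inj.
have e10 : lift i1 (0 : 'I_2) = i0 by apply: val_inj.
have e11 : lift i1 (1 : 'I_2) = i2 by apply: val_inj.
have e20 : lift i2 (0 : 'I_2) = i0 by apply: val_inj.
have e21 : lift i2 (1 : 'I_2) = i1 by apply: val_inj.
move: k zk {cj}; apply: ord3P => zk;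
  rewrite ?(e00, e01, e10, e11, e20, e21) /=;
  move: (qderiv Q) (z i0) (z i1) (z i2) zk => J z0 z1 z2 zk E2 E1 E0.
- have -> : J i0 i0 z = (c * z0 *+ 2 - J i0 i1 z * z1 - J i0 i2 z * z2) / z0 by rewrite -E0; field.
  have -> : J i1 i0 z = (c * z1 *+ 2 - J i1 i1 z * z1 - J i1 i2 z * z2) / z0 by rewrite -E1; field.
  have -> : J i2 i0 z = (c * z2 *+ 2 - J i2 i1 z * z1 - J i2 i2 z * z2) / z0 by rewrite -E2; field.
  by split; field; rewrite c0 zk.
- have -> : J i0 i1 z = (c * z0 *+ 2 - J i0 i0 z * z0 - J i0 i2 z * z2) / z1 by rewrite -E0; field.
  have -> : J i1 i1 z = (c * z1 *+ 2 - J i1 i0 z * z0 - J i1 i2 z * z2) / z1 by rewrite -E1; field.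
  have -> : J i2 i1 z = (c * z2 *+ 2 - J i2 i0 z * z0 - J i2 i2 z * z2) / z1 by rewrite -E2; field.
  by split; field; rewrite c0 zk.
- have -> : J i0 i2 z = (c * z0 *+ 2 - J i0 i0 z * z0 - J i0 i1 z * z1) / z2 by rewrite -E0; field.
  have -> : J i1 i2 z = (c * z1 *+ 2 - J i1 i0 z * z0 - J i1 i1 z * z1) / z2 by rewrite -E1; field.
  have -> : J i2 i2 z = (c * z2 *+ 2 - J i2 i0 z * z0 - J i2 i1 z * z1) / z2 by rewrite -E2; field.
  by split; field; rewrite c0 zk.
Qed.
End Vectors.

(** * Change of coordinates *)

Section Transport.
Variable F : fieldType.
Implicit Types (z w a : vec3 F) (Q : quadmap F) (g h : 'M[F]_3) (p : 'I_4 -> vec3 F).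

Lemma vscaleA c d z : vscale c (vscale d z) = vscale (c * d) z.
Proof. by apply: vec_ext => i; rewrite /vscale mulrA. Qed.

Lemma vscale1 z : vscale 1 z = z.
Proof. by apply: vec_ext => i; rewrite /vscale mul1r. Qed.

Lemma proj_eqP z w : proj_eq z w <-> exists2 c, c != 0 & w = vscale c z.
Proof.
split=> [[c [c0 e]]|[c c0 ->]]; last by exists c.
by exists c => //; apply: vec_ext.
Qed.

Lemma proj_eq_refl z : proj_eq z z.
Proof. by apply/proj_eqP; exists 1; rewrite ?oner_neq0 ?vscale1. Qed.

Lemma proj_eq_sym z w : proj_eq z w -> proj_eq w z.
Proof.
move=> /proj_eqP[c c0 ->]; apply/proj_eqP; exists c^-1; rewrite ?invr_eq0 //.
by rewrite vscaleA mulVf // vscale1.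
Qed.

Lemma proj_eq_trans x z w : proj_eq x z -> proj_eq z w -> proj_eq x w.
Proof.
move=> /proj_eqP[c c0 ->] /proj_eqP[d d0 ->]; apply/proj_eqP; exists (d * c).
  by rewrite mulf_neq0.
by rewrite vscaleA.
Qed.

Lemma proj_eq_mxapp g z w : proj_eq z w -> proj_eq (mxapp g z) (mxapp g w).
Proof.
by move=> /proj_eqP[c c0 ->]; apply/proj_eqP; exists c; rewrite ?mxappZ.
Qed.

Lemma proj_eq_mxappI g z w : g \in unitmx ->
  proj_eq (mxapp g z) (mxapp g w) -> proj_eq z w.
Proof. by move=> ug /(proj_eq_mxapp (invmx g)); rewrite !mxappK. Qed.

Lemma nonzeroP z : nonzero z <-> z <> vscale 0 z.
Proof.
split=> [[i zi] e|nz].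
  by move: zi; rewrite e /vscale mul0r eqxx.
case: (boolP [exists i, z i != 0]) => [/existsP//|/existsPn z0].
by case: nz; apply: vec_ext => i; rewrite /vscale mul0r; apply/eqP; rewrite -[_ == _]negbK.
Qed.

Lemma nonzero_mxapp g z : g \in unitmx -> nonzero z -> nonzero (mxapp g z).
Proof.
move=> ug /nonzeroP nz; apply/nonzeroP => e; apply: nz.
by rewrite -[LHS](mxappK z ug) {1}e mxappZ mxappK.
Qed.

Lemma nonzero_proj z w : proj_eq z w -> nonzero z -> nonzero w.
Proof. by move=> [c [c0 e]] [i zi]; exists i; rewrite e mulf_neq0. Qed.

(** Conjugacy of homogeneous lifts; [lam] absorbs a rescaling of the coefficients, invisible on the
    projective plane. *)
Definition intertwines g lam Q Q' :=
  forall z, qeval Q' (mxapp g z) = vscale lam (mxapp g (qeval Q z)).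

Lemma intertwines_inv g lam Q Q' : g \in unitmx -> lam != 0 ->
  intertwines g lam Q Q' -> intertwines (invmx g) lam^-1 Q' Q.
Proof.
move=> ug l0 e z; have := e (mxapp (invmx g) z); rewrite mxappVK // => ->.
by rewrite mxappZ mxappK // vscaleA mulVf // vscale1.
Qed.

Lemma jac_conj g lam Q Q' z : intertwines g lam Q Q' ->
  jac Q' (mxapp g z) *m g = lam *: (g *m jac Q z).
Proof.
move=> e; apply: mx_ext => w.
have sE (h : 'M[F]_3) : mxapp (lam *: h) w = vscale lam (mxapp h w).
  apply: vec_ext => i; rewrite /mxapp /vscale !sum3 !mxE. ring.
rewrite mxapp_mul sE mxapp_mul -!jac_polar -mxappD !e !(mxappD, mxappZ).
apply: vec_ext => i; rewrite /vscale /vadd. ring.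
Qed.

Lemma fixedP Q z : is_fixed Q z <->
  nonzero z /\ exists c, qeval Q z = vscale c z.
Proof.
split=> -[nz [c e]]; split=> //; exists c; first exact: vec_ext.
by move=> i; rewrite e.
Qed.

Lemma holo_fixed Q z c : holo Q -> nonzero z -> qeval Q z = vscale c z -> c != 0.
Proof.
move=> hQ [i zi] e; apply: contraNneq zi => c0; apply/eqP/(hQ z) => m.
by rewrite e /vscale c0 mul0r.
Qed.

Lemma fixed_conj g lam Q Q' z w : g \in unitmx -> intertwines g lam Q Q' ->
  proj_eq (mxapp g z) w -> is_fixed Q z -> is_fixed Q' w.
Proof.
move=> ug eg zw /fixedP[nz [c e]]; apply/fixedP; split.
  by apply: nonzero_proj zw _; apply: nonzero_mxapp.
have /proj_eqP[k k0 ->] := zw; exists (k * lam * c).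
by rewrite qevalZ eg e mxappZ !vscaleA; congr vscale; ring.
Qed.

(** With w = k g z, the eigenvalue and the Jacobian both acquire the factor [k * lam], so the
    normalized Jacobian is merely conjugated by [g]. *)
Lemma invariants_conj g lam Q Q' z w c : g \in unitmx -> lam != 0 ->
  intertwines g lam Q Q' -> proj_eq (mxapp g z) w ->
  nonzero z -> c != 0 -> qeval Q z = vscale c z ->
  trI Q' w = trI Q z /\ detI Q' w = detI Q z.
Proof.
move=> ug l0 eg zw nz c0 e.
have nw : nonzero w by apply: nonzero_proj zw _; apply: nonzero_mxapp.
have [k k0 wE] := proj1 (proj_eqP _ _) zw.
have eQ i : qeval Q z i = c * z i by rewrite e.
have eQ' i : qeval Q' w i = (k * lam * c) * w i.
  by rewrite wE qevalZ eg e mxappZ !vscaleA /vscale; ring.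
have c'0 : k * lam * c != 0 by rewrite !mulf_neq0.
have [-> ->] := trI_detI_jac nz c0 eQ.
have [-> ->] := trI_detI_jac nw c'0 eQ'.
have jE : jac Q' w = (k * lam) *: (g *m jac Q z *m invmx g).
  rewrite wE jacZ -[jac Q' _](mulmxK ug) (jac_conj _ eg).
  by rewrite -scalemxAl scalerA.
rewrite jE; split.
  rewrite mxtraceZ mxtrace_mulC mulmxA mulVmx // mul1mx.
  by field; rewrite c0 l0 k0.
congr (- _); rewrite scalerA.
have -> : (k * lam * c)^-1 * (k * lam) = c^-1 by field; rewrite c0 l0 k0.
have -> : 1%:M - c^-1 *: (g *m jac Q z *m invmx g)
       = g *m (1%:M - c^-1 *: jac Q z) *m invmx g.
  by rewrite mulmxBr mulmxBl mulmx1 mulmxV // -scalemxAr -scalemxAl.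
by rewrite !det_mulmx det_inv mulrC mulKf // -unitfE -unitmxE.
Qed.

(** Serves both to carry a normal form onto the line [a] and to bring an arbitrary marked map to the
    standard points. *)
Lemma E4_transport g lam a a' Q Q' p p' : g \in unitmx -> lam != 0 ->
  intertwines g lam Q Q' ->
  (forall z, on_line a z <-> on_line a' (mxapp g z)) ->
  (forall i, proj_eq (mxapp g (p i)) (p' i)) ->
  E4 a Q p -> E4 a' Q' p' /\ forall x, Psi Q' p' x = Psi Q p x.
Proof.
move=> ug l0 eg la pp [hQ [pl [[n [s iso]] [simp [fp [dp cp]]]]]].
have ug' : invmx g \in unitmx by rewrite unitmx_inv.
have eg' := intertwines_inv ug l0 eg.
have line_proj z w : proj_eq z w -> on_line a' z -> on_line a' w.
  move=> /proj_eqP[c _ ->]; rewrite /on_line /lin /vscale !sum3 => e.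
  have -> : a' i0 * (c * z i0) + a' i1 * (c * z i1) + a' i2 * (c * z i2) =
    c * (a' i0 * z i0 + a' i1 * z i1 + a' i2 * z i2) by ring.
  by rewrite e mulr0.
have fixV z' : is_fixed Q' z' -> is_fixed Q (mxapp (invmx g) z').
  by apply: (fixed_conj ug' eg'); apply: proj_eq_refl.
have inv z w : proj_eq (mxapp g z) w -> is_fixed Q z ->
    trI Q' w = trI Q z /\ detI Q' w = detI Q z.
  move=> zw /fixedP[nz [c e]].
  exact: (invariants_conj ug l0 eg zw nz (holo_fixed hQ nz e) e).
split; last first.
  move=> [i b]; rewrite /Psi /=; have [fi _] := fp i.
  by have [-> ->] := inv _ _ (pp i) fi.
split.
  move=> z' z0; have /hQ z1 : forall m, qeval Q (mxapp (invmx g) z') m = 0.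
    move=> m; rewrite eg' /vscale /mxapp !sum3 !z0; ring.
  by move=> i; rewrite -(mxappVK z' ug) (vec_ext (w := fun=> 0) z1) /mxapp sum3; ring.
split.
  move=> z'; rewrite -(mxappVK z' ug) => /la /pl /la.
  rewrite eg; apply: line_proj; apply/proj_eqP; by exists lam.
split.
  exists n, (fun i => mxapp g (s i)) => z' /fixV /iso[i si]; exists i.
  by rewrite -(mxappVK z' ug); apply: proj_eq_mxapp.
split.
  move=> z' /fixV fz; rewrite /simple_fixed.
  have zz : proj_eq (mxapp g (mxapp (invmx g) z')) z'.
    by rewrite mxappVK //; apply: proj_eq_refl.
  by have [_ ->] := inv _ _ zz fz; apply: simp.
split.
  move=> i; have [fi ni] := fp i; split; first exact: fixed_conj (pp i) fi.
  by move=> /(line_proj _ _ (proj_eq_sym (pp i))) /la.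
split.
  move=> i j ij; apply: dp; apply: (proj_eq_mxappI ug).
  apply: proj_eq_trans (pp i) _; apply: proj_eq_trans ij _.
  exact: proj_eq_sym.
move=> z' /fixV fz nz; have [|i pi] := cp _ fz.
  by move=> /la; rewrite mxappVK.
exists i; apply: proj_eq_trans (proj_eq_sym (pp i)) _.
by rewrite -(mxappVK z' ug); apply: proj_eq_mxapp.
Qed.

Definition conjQ g Q : quadmap F := fun m i j =>
  \sum_(k < 3) g m k *
    ((invmx g)^T *m (\matrix_(u, v) Q k u v) *m invmx g) i j.

Lemma qeval_form (B : 'M[F]_3) z :
  \sum_(i < 3) \sum_(j < 3) B i j * z i * z j =
  ((\col_i z i)^T *m B *m \col_i z i) 0 0.
Proof. by rewrite !(mxE, sum3); ring. Qed.

Lemma intertwines_conjQ g Q : g \in unitmx -> intertwines g 1 Q (conjQ g Q).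
Proof.
move=> ug z; apply: vec_ext => m; rewrite /vscale mul1r.
transitivity (\sum_(k < 3) g m k * \sum_(i < 3) \sum_(j < 3)
  ((invmx g)^T *m (\matrix_(u, v) Q k u v) *m invmx g) i j * mxapp g z i * mxapp g z j).
  by rewrite /qeval /conjQ !sum3; ring.
rewrite {1}/mxapp; apply: eq_bigr => k _; congr (_ * _).
rewrite qeval_form; have -> : \col_i mxapp g z i = g *m \col_i z i.
  by apply/colP => i; rewrite !mxE /mxapp; apply: eq_bigr => j _; rewrite mxE.
rewrite trmx_mul !mulmxA -[_ *m g^T *m _]mulmxA -trmx_mul mulVmx // trmx1 mulmx1.
rewrite -[_ *m invmx g *m g]mulmxA mulVmx // mulmx1 -qeval_form /qeval.
by apply: eq_bigr => i _; apply: eq_bigr => j _; rewrite mxE.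
Qed.
End Transport.

(** * Normal form *)

Definition j0 : 'I_4 := @Ordinal 4 0 isT.
Definition j1 : 'I_4 := @Ordinal 4 1 isT.
Definition j2 : 'I_4 := @Ordinal 4 2 isT.
Definition j3 : 'I_4 := @Ordinal 4 3 isT.

Lemma ord4P (P : 'I_4 -> Prop) : P j0 -> P j1 -> P j2 -> P j3 -> forall i, P i.
Proof.
move=> P0 P1 P2 P3 [[|[|[|[|//]]]] hi].
- by rewrite (_ : Ordinal hi = j0) //; apply: val_inj.
- by rewrite (_ : Ordinal hi = j1) //; apply: val_inj.
- by rewrite (_ : Ordinal hi = j2) //; apply: val_inj.
- by rewrite (_ : Ordinal hi = j3) //; apply: val_inj.
Qed.

Section NormalForm.
Variable F : fieldType.
Implicit Types (z w a M s u : vec3 F).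

(** Resultant of the binary quadratic forms with coefficients (a, b, c) and (d, e, f). *)
Definition res2 (a b c d e f : F) : F :=
  (a * f - c * d) ^+ 2 - (a * e - b * d) * (b * f - c * e).

Lemma res2_eq0 (a b c d e f x y : F) : (x != 0) || (y != 0) ->
  a * x ^+ 2 + b * x * y + c * y ^+ 2 = 0 ->
  d * x ^+ 2 + e * x * y + f * y ^+ 2 = 0 -> res2 a b c d e f = 0.
Proof.
rewrite /res2 => xy P0 Q0.
have [x0|x0] := eqVneq x 0.
  rewrite x0 eqxx /= in xy; rewrite x0 in P0 Q0.
  have c0 : c = 0.
    by apply: (mulIf (expf_neq0 2 xy)); rewrite mul0r -[RHS]P0; ring.
  have f0 : f = 0.
    by apply: (mulIf (expf_neq0 2 xy)); rewrite mul0r -[RHS]Q0; ring.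
  by rewrite c0 f0; ring.
have [y0|y0] := eqVneq y 0.
  rewrite y0 in P0 Q0.
  have a0 : a = 0.
    by apply: (mulIf (expf_neq0 2 x0)); rewrite mul0r -[RHS]P0; ring.
  have d0 : d = 0.
    by apply: (mulIf (expf_neq0 2 x0)); rewrite mul0r -[RHS]Q0; ring.
  by rewrite a0 d0; ring.
(* [e1] and [e2] say that the symmetric Bezout matrix of the two forms kills (x, y); [res2] is minus
   its determinant. *)
have e1 : (a * e - b * d) * x + (a * f - c * d) * y = 0.
  apply: (mulfI y0); rewrite mulr0.
  transitivity (a * (d * x ^+ 2 + e * x * y + f * y ^+ 2)
             - d * (a * x ^+ 2 + b * x * y + c * y ^+ 2)); first by ring.
  by rewrite P0 Q0; ring.
have e2 : (a * f - c * d) * x + (b * f - c * e) * y = 0.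
  apply: (mulfI x0); rewrite mulr0.
  transitivity (f * (a * x ^+ 2 + b * x * y + c * y ^+ 2)
             - c * (d * x ^+ 2 + e * x * y + f * y ^+ 2)); first by ring.
  by rewrite P0 Q0; ring.
apply: (mulfI x0); rewrite mulr0.
transitivity ((a * f - c * d) * ((a * f - c * d) * x + (b * f - c * e) * y)
  - (b * f - c * e) * ((a * e - b * d) * x + (a * f - c * d) * y)); first by ring.
by rewrite e1 e2; ring.
Qed.

(* The 3x3 matrix with zero row sums whose off-diagonal entries are
   A_{12}, A_{21} = s_0 +- u_0, A_{20}, A_{02} = s_1 +- u_1, A_{01}, A_{10} = s_2 +- u_2. *)
Definition amat s u : 'I_3 -> vec3 F :=
  mk3 (mk3 (- (s i1 + s i2) + u i1 - u i2) (s i2 + u i2) (s i1 - u i1))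
      (mk3 (s i2 - u i2) (- (s i0 + s i2) + u i2 - u i0) (s i0 + u i0))
      (mk3 (s i1 + u i1) (s i0 - u i0) (- (s i0 + s i1) + u i0 - u i1)).

(* As the row sums of [A] vanish, the three cofactors of a row agree; the left
   kernel is thus spanned by the negated principal 2x2 minors, the numbers D_i. *)
Definition lvec s u : vec3 F :=
  let A := amat s u in
  mk3 (A i1 i2 * A i2 i1 - A i1 i1 * A i2 i2)
      (A i0 i2 * A i2 i0 - A i0 i0 * A i2 i2)
      (A i0 i1 * A i1 i0 - A i0 i0 * A i1 i1).

(* P_m = z_m M(z) + A_{m0} z_1 z_2 + A_{m1} z_0 z_2 + A_{m2} z_0 z_1 *)
Definition nfQ M s u : quadmap F := fun m i j =>
  (i == m)%:R * M j +
  match val i, val j with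
  | 0%N, 1%N => amat s u m i2
  | 0%N, 2%N => amat s u m i1
  | 1%N, 2%N => amat s u m i0
  | _, _ => 0
  end.

Definition rvec s u z : vec3 F := fun m =>
  amat s u m i0 * (z i1 * z i2) + amat s u m i1 * (z i0 * z i2)
  + amat s u m i2 * (z i0 * z i1).

Lemma nfQ_eval M s u z m : qeval (nfQ M s u) z m = z m * lin M z + rvec s u z m.
Proof.
rewrite /qeval /lin /rvec !sum3 /nfQ; move: (amat s u) => A.
by move: m; apply: ord3P => /=; ring.
Qed.

Lemma nfQ_qderiv M s u z m l : qderiv (nfQ M s u) m l z =
  (l == m)%:R * lin M z + z m * M l +
  mk3 (amat s u m i1 * z i2 + amat s u m i2 * z i1)
      (amat s u m i0 * z i2 + amat s u m i2 * z i0)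
      (amat s u m i0 * z i1 + amat s u m i1 * z i0) l.
Proof.
rewrite /qderiv /lin !sum3 /nfQ; move: (amat s u) => A.
by move: m l; apply: ord3P; apply: ord3P => /=; ring.
Qed.

Lemma lin_lvec_rvec s u z : lin (lvec s u) (rvec s u z) = 0.
Proof. by rewrite /lin sum3 /lvec /rvec /amat /=; ring. Qed.

Lemma lin_lvec_nfQ M s u z :
  lin (lvec s u) (qeval (nfQ M s u) z) = lin (lvec s u) z * lin M z.
Proof.
rewrite -[RHS]addr0 -(lin_lvec_rvec s u z) {1 2 4}/lin !sum3 !nfQ_eval.
by rewrite /lin !sum3; ring.
Qed.

Definition stdpt (i : 'I_4) : vec3 F :=
  match val i with
  | 0%N => unitv F i0 | 1%N => unitv F i1 | 2%N => unitv F i2 | _ => fun=> 1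
  end.

Definition mval M (i : 'I_4) : F := lin M (stdpt i).

Lemma mvalE M : [/\ mval M j0 = M i0, mval M j1 = M i1, mval M j2 = M i2
  & mval M j3 = M i0 + M i1 + M i2].
Proof. by rewrite /mval /lin !sum3 /stdpt /unitv /=; split; ring. Qed.

Lemma stdpt_nonzero i : nonzero (stdpt i).
Proof.
move: i; apply: ord4P; [exists i0|exists i1|exists i2|exists i0];
  by rewrite /stdpt /unitv /= oner_neq0.
Qed.

Lemma nfQ_stdpt M s u i :
  qeval (nfQ M s u) (stdpt i) = vscale (mval M i) (stdpt i).
Proof.
apply: vec_ext => m; rewrite nfQ_eval /vscale /mval /rvec /lin.
by move: i m; apply: ord4P; apply: ord3P; rewrite !sum3 /stdpt /unitv /amat /=; ring.
Qed.

(** R vanishes at the point, so Df - I is the derivative of R divided by M_i, on the tangent space.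
    The sign flips at (1,1,1) because there the derivative is -A, whose principal minors add up to
    minus the sum of the entries of [lvec]. *)
Lemma nfQ_inv_stdpt M s u i : mval M i != 0 ->
  trI (nfQ M s u) (stdpt i) = - (mval s i *+ 2) / mval M i /\
  detI (nfQ M s u) (stdpt i) =
    (if i == j3 then - mval (lvec s u) i else mval (lvec s u) i) / mval M i ^+ 2.
Proof.
move=> m0; have e k : qeval (nfQ M s u) (stdpt i) k = mval M i * stdpt i k.
  by rewrite nfQ_stdpt.
have [-> ->] := trI_detI_jac (stdpt_nonzero i) m0 e.
rewrite /mxtrace det_mx33 sum3 !mxE !nfQ_qderiv -[lin M (stdpt i)]/(mval M i).
have [s0 s1 s2 s3] := mvalE s; have [l0 l1 l2 l3] := mvalE (lvec s u).
have [m_0 m_1 m_2 m_3] := mvalE M; move: m0 {e}.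
move: i; apply: ord4P => m0; rewrite ?(s0, s1, s2, s3) ?(l0, l1, l2, l3);
  rewrite ?(m_0, m_1, m_2, m_3) in m0 *;
  rewrite /lvec /stdpt /unitv /amat /=;
  by split; field.
Qed.

(* First two components of the map on the line, divided by L_2, in the
   parametrization (L_2 x, L_2 y, - L_0 x - L_1 y). *)
Definition line_p M s u : vec3 F :=
  let A := amat s u i0 in let L := lvec s u in
  mk3 (- (A i1 * L i0) + (M i0 * L i2 - M i2 * L i0))
      (- (A i0 * L i0) - A i1 * L i1 + A i2 * L i2 + (M i1 * L i2 - M i2 * L i1))
      (- (A i0 * L i1)).

Definition line_q M s u : vec3 F :=
  let A := amat s u i1 in let L := lvec s u in
  mk3 (- (A i1 * L i0))
      (- (A i0 * L i0) - A i1 * L i1 + A i2 * L i2 + (M i0 * L i2 - M i2 * L i0))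
      (- (A i0 * L i1) + (M i1 * L i2 - M i2 * L i1)).

Definition holo_cond (p q : vec3 F) : F :=
  res2 (p i0) (p i1) (p i2) (q i0) (q i1) (q i2).

(* Resultant of the two partial derivatives of the binary cubic
   [x q(x, y) - y p(x, y)] whose zeros are the fixed points of [(p : q)]. *)
Definition fix_cond (p q : vec3 F) : F :=
  res2 (3%:R * q i0) (2%:R * (q i1 - p i0)) (q i2 - p i1)
       (q i1 - p i0) (2%:R * (q i2 - p i1)) (- (3%:R * p i2)).

Definition qf2 (p : vec3 F) (x y : F) := p i0 * x ^+ 2 + p i1 * x * y + p i2 * y ^+ 2.

Definition line_pt s u (x y : F) : vec3 F :=
  mk3 (lvec s u i2 * x) (lvec s u i2 * y) (- (lvec s u i0 * x + lvec s u i1 * y)).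

Lemma line_ptP s u z : lvec s u i2 != 0 -> on_line (lvec s u) z ->
  z = line_pt s u (z i0 / lvec s u i2) (z i1 / lvec s u i2).
Proof.
rewrite /line_pt /on_line /lin sum3; move: (lvec s u) => L l2 e; apply: vecP => /=.
- by field.
- by field.
apply: (mulfI l2); apply/eqP; rewrite -subr_eq0; apply/eqP.
by rewrite -[RHS]e; field.
Qed.

Lemma nfQ_line_pt M s u x y (z := line_pt s u x y) :
  qeval (nfQ M s u) z i0 = lvec s u i2 * qf2 (line_p M s u) x y /\
  qeval (nfQ M s u) z i1 = lvec s u i2 * qf2 (line_q M s u) x y.
Proof.
rewrite !nfQ_eval /rvec /lin !sum3 /qf2 /line_p /line_q /z /line_pt /=.
by move: (lvec s u) (amat s u) => L A; split; ring.
Qed.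

Lemma line_ptD s u x y x' y' :
  vadd (line_pt s u x y) (line_pt s u x' y') = line_pt s u (x + x') (y + y').
Proof. by rewrite /line_pt; apply: vecP; rewrite /vadd /=; ring. Qed.

(** As L_2 is nonzero the first two rows of A are independent; having zero sums, they force z_1 z_2
    = z_0 z_2 = z_0 z_1, whose only solutions are the four base points of the pencil. *)
Lemma rvec_eq0 s u z : lvec s u i2 != 0 -> nonzero z ->
  (forall m, rvec s u z m = 0) -> exists i, proj_eq (stdpt i) z.
Proof.
move=> l2 nz r0.
have [h1 h2] : z i0 * z i2 = z i1 * z i2 /\ z i0 * z i1 = z i1 * z i2.
  have := r0 i0; have := r0 i1; rewrite /rvec => e1 e0.
  split; apply/eqP; rewrite -subr_eq0; apply/eqP;
    apply: (mulfI l2); rewrite mulr0.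
    transitivity (amat s u i0 i2 * 0 - amat s u i1 i2 * 0); last by ring.
    by rewrite -{1}e1 -e0 /lvec /amat /=; ring.
  transitivity (amat s u i1 i1 * 0 - amat s u i0 i1 * 0); last by ring.
  by rewrite -{1}e0 -e1 /lvec /amat /=; ring.
have [z0|z0] := eqVneq (z i0) 0.
  have z12 : z i1 * z i2 = 0 by rewrite -h1 z0 mul0r.
  move/eqP: z12; rewrite mulf_eq0 => /orP[/eqP z1|/eqP z2].
    exists j2; apply/proj_eqP; exists (z i2); last first.
      by apply: vecP; rewrite /vscale /stdpt /unitv /= ?z0 ?z1; ring.
    case: nz => i; move: i; apply: ord3P; rewrite ?z0 ?z1 ?eqxx //.
  exists j1; apply/proj_eqP; exists (z i1); last first.
    by apply: vecP; rewrite /vscale /stdpt /unitv /= ?z0 ?z2; ring.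
  by case: nz => i; move: i; apply: ord3P; rewrite ?z0 ?z2 ?eqxx.
have z21 : z i2 = z i1 by apply: (mulfI z0); rewrite h1 h2.
rewrite z21 in h1 h2.
have [z1|z1] := eqVneq (z i1) 0.
  exists j0; apply/proj_eqP; exists (z i0) => //.
  by apply: vecP; rewrite /vscale /stdpt /unitv /= ?z21 ?z1; ring.
have z10 : z i0 = z i1 by apply: (mulIf z1).
exists j3; apply/proj_eqP; exists (z i0) => //.
by apply: vecP; rewrite /vscale /stdpt /unitv /= ?z21 ?z10; ring.
Qed.

Lemma stdpt_inj i j : proj_eq (stdpt i) (stdpt j) -> i = j.
Proof.
move=> [c [c0 e]].
have {}e k : (stdpt j k == 0) = (stdpt i k == 0).
  by rewrite e mulf_eq0 (negbTE c0).
have := e i0; have := e i1; have := e i2; rewrite /stdpt /unitv {e c0}.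
by move: i j; apply: ord4P; apply: ord4P; rewrite //= ?eqxx ?oner_eq0.
Qed.

Lemma inv_proj (Q : quadmap F) z w : holo Q -> is_fixed Q z -> proj_eq z w ->
  trI Q w = trI Q z /\ detI Q w = detI Q z.
Proof.
move=> hQ /fixedP[nz [c e]] zw.
apply: (@invariants_conj _ 1%:M 1 Q Q z w c); rewrite ?unitmx1 ?oner_neq0 //.
- by move=> x; rewrite !mxapp1 vscale1.
- by rewrite mxapp1.
exact: holo_fixed hQ nz e.
Qed.
End NormalForm.

(** * Normal forms satisfying the resultant conditions belong to E4 *)

Section NormalFormE4.
Variable F : closedFieldType.
Variables M s u : vec3 F.
Let L := lvec s u.
Let N := nfQ M s u.
Hypothesis M_neq0 : forall i, mval M i != 0.
Hypothesis L_neq0 : forall i, mval L i != 0.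
Hypothesis holo_neq0 : holo_cond (line_p M s u) (line_q M s u) != 0.
Hypothesis fix_neq0 : fix_cond (line_p M s u) (line_q M s u) != 0.
Implicit Types (z w : vec3 F).

Lemma L2_neq0 : L i2 != 0.
Proof. by have [_ _ <- _] := mvalE L. Qed.

Lemma stdpt_off_line i : ~ on_line L (stdpt F i).
Proof. by rewrite /on_line; apply/eqP; exact: L_neq0. Qed.

Lemma nf_line_coord z : on_line L z -> nonzero z -> exists x y,
  [/\ z = line_pt s u x y, (x != 0) || (y != 0) & z i0 = L i2 * x /\ z i1 = L i2 * y].
Proof.
move=> lz nz; have e := line_ptP L2_neq0 lz.
exists (z i0 / L i2), (z i1 / L i2); split=> //; last first.
  by split; rewrite mulrC divfK // L2_neq0.
apply/negP => /negP; rewrite negb_or !negbK => /andP[/eqP x0 /eqP y0].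
case/nonzeroP: nz; rewrite e -/L x0 y0 /line_pt.
by apply: vecP; rewrite /vscale /=; ring.
Qed.

Lemma nf_off_line z c : nonzero z -> ~ on_line L z -> qeval N z = vscale c z ->
  exists i, proj_eq (stdpt F i) z.
Proof.
move=> nz lz e; apply: (rvec_eq0 L2_neq0 nz) => m.
have cM : c = lin M z.
  have := lin_lvec_nfQ M s u z; rewrite -/L -/N e => /eqP.
  have -> : lin L (vscale c z) = lin L z * c by rewrite /lin /vscale !sum3; ring.
  rewrite -subr_eq0 -mulrBr mulf_eq0 subr_eq0 => /orP[/eqP //|/eqP //].
have : qeval N z m = c * z m by rewrite e.
rewrite nfQ_eval cM => /eqP; rewrite -subr_eq0 => /eqP <-; ring.
Qed.

Lemma nf_line_comp z x y c : z = line_pt s u x y -> z i0 = L i2 * x -> z i1 = L i2 * y ->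
  qeval N z = vscale c z ->
  qf2 (line_p M s u) x y = c * x /\ qf2 (line_q M s u) x y = c * y.
Proof.
move=> ez z0 z1 e; have [] := nfQ_line_pt M s u x y; rewrite -ez -/N e /vscale z0 z1.
by rewrite -/L !(mulrCA c) => /(mulfI L2_neq0) -> /(mulfI L2_neq0) ->.
Qed.

Lemma nf_holo : holo N.
Proof.
move=> z z0 i; apply/eqP/negPn/negP => zi.
have nz : nonzero z by exists i.
(* A common zero is treated as an eigenvector with eigenvalue 0, so the lemmas on fixed points apply
   to it. *)
have e : qeval N z = vscale 0 z by apply: vec_ext => m; rewrite /vscale z0 mul0r.
have [lz|/eqP lz] := eqVneq (lin L z) 0; last first.
  have [j /proj_eqP[k k0 zE]] := nf_off_line nz lz e.
  move: zi; rewrite zE; have : qeval N z i = 0 by [].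
  rewrite zE qevalZ nfQ_stdpt /vscale => /eqP.
  rewrite mulf_eq0 expf_eq0 /= (negbTE k0) mulf_eq0 (negbTE (M_neq0 _)) /= => /eqP ->.
  by rewrite mulr0 eqxx.
have [x [y [ez xy [zx zy]]]] := nf_line_coord lz nz.
have [] := nf_line_comp ez zx zy e; rewrite !mul0r => p0 q0.
by move: holo_neq0; rewrite /holo_cond (res2_eq0 xy p0 q0) eqxx.
Qed.

Lemma nf_preserves : preserves_line L N.
Proof. by move=> z lz; rewrite /on_line lin_lvec_nfQ lz mul0r. Qed.

Lemma nf_fixed_stdpt i : is_fixed N (stdpt F i).
Proof. apply/fixedP; split; first exact: stdpt_nonzero. by exists (mval M i); apply: nfQ_stdpt. Qed.

(* The multiplier transverse to the line is M(z)/c, which is not 1 because R has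
   no zero on the line; so if I - Df is singular, its kernel is tangent to the
   line and z is a double root of the binary cubic of [fix_cond]. *)
Lemma nf_simple_line z : is_fixed N z -> on_line L z -> simple_fixed N z.
Proof.
move=> /fixedP[nz [c e]] lz; have c0 := holo_fixed nf_holo nz e.
have eQ m : qeval N z m = c * z m by rewrite e.
rewrite /simple_fixed (proj2 (trI_detI_jac nz c0 eQ)) oppr_eq0.
rewrite -det_tr; apply/det0P => -[v v0 /rowP ev].
pose w : vec3 F := fun i => v 0 i.
have nw : nonzero w.
  by case/rV0Pn: v0 => j vj; exists j.
have Jw m : \sum_(l < 3) qderiv N m l z * w l = c * w m.
  have := ev m; rewrite !mxE sum3 !mxE !sum3 /w => h.
  apply: (mulfI (invr_neq0 c0)); rewrite mulKf //.
  apply/eqP; rewrite eq_sym -subr_eq0; apply/eqP; rewrite -[RHS]h.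
  by move: m {h}; apply: ord3P => /=; ring.
(* The derivative of L o P = L M at z in the direction w, using L(z) = 0. *)
have lMw : lin L w * (lin M z - c) = 0.
  have : lin L (fun m => \sum_(l < 3) qderiv N m l z * w l) = c * lin L w.
    have -> : (fun m => \sum_(l < 3) qderiv N m l z * w l) = vscale c w.
      exact: vec_ext.
    by rewrite /lin /vscale !sum3; ring.
  move=> h; rewrite mulrBr [lin L w * c]mulrC -h.
  rewrite {1 3}/lin !sum3 !nfQ_qderiv /=.
  have := lz; rewrite /on_line => h0.
  transitivity (- (lin L z) * lin M w); last by rewrite h0; ring.
  by rewrite /lin !sum3 /L /lvec /amat /=; ring.
have lw : on_line L w.
  move/eqP: lMw; rewrite mulf_eq0 subr_eq0 => /orP[/eqP //|/eqP cM].
  have [m|i /proj_eqP[k k0 zE]] := rvec_eq0 L2_neq0 nz.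
    have := eQ m; rewrite nfQ_eval cM => /eqP; rewrite -subr_eq0 => /eqP <-.
    by ring.
  case: (@stdpt_off_line i); move: lz; rewrite zE /on_line.
  rewrite (_ : lin L (vscale k _) = k * lin L (stdpt F i)).
    by move/eqP; rewrite mulf_eq0 (negbTE k0) => /eqP.
  by rewrite /lin /vscale !sum3; ring.
have [x [y [ez xy [zx zy]]]] := nf_line_coord lz nz.
have [x' [y' [ew xy' [wx wy]]]] := nf_line_coord lw nw.
have [] := nf_line_comp ez zx zy e.
have := line_ptD s u x y x' y'; rewrite -ez -ew => zw.
have := jac_polar N z w; rewrite zw => pol.
have [a1 b1] := nfQ_line_pt M s u (x + x') (y + y').
have [a2 b2] := nfQ_line_pt M s u x y.
have [a3 b3] := nfQ_line_pt M s u x' y'.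
move: a1 a2 a3 b1 b2 b3; rewrite -ez -ew -/N -/L => a1 a2 a3 b1 b2 b3.
have cmp m : qeval N (line_pt s u (x + x') (y + y')) m - qeval N z m - qeval N w m
   = c * w m.
  rewrite -Jw; have := congr1 (fun f => f m) pol.
  rewrite /mxapp /vadd /vscale => h.
  transitivity (\sum_(j < 3) jac N z m j * w j).
    by rewrite -h; ring.
  by apply: eq_bigr => j _; rewrite mxE.
have := cmp i0; have := cmp i1.
rewrite a1 a2 a3 b1 b2 b3 wx wy {a1 a2 a3 b1 b2 b3 cmp pol zw}.
rewrite -!mulrBr !(mulrCA c) => /(mulfI L2_neq0) dq /(mulfI L2_neq0) dp.
move: fix_neq0; move: dp dq; rewrite /fix_cond /qf2.
move: (line_p M s u i0) (line_p M s u i1) (line_p M s u i2) => p0 p1 p2.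
move: (line_q M s u i0) (line_q M s u i1) (line_q M s u i2) => q0 q1 q2.
move=> dp dq f0 px qx.
(* Partial derivatives of the cubic x q - y p. [g1] is Euler's relation at a zero of the cubic; [g2]
   says that its derivative along (x', y') vanishes as well. *)
pose fx := 3%:R * q0 * x ^+ 2 + 2%:R * (q1 - p0) * x * y + (q2 - p1) * y ^+ 2.
pose fy := (q1 - p0) * x ^+ 2 + 2%:R * (q2 - p1) * x * y + - (3%:R * p2) * y ^+ 2.
have g1 : fx * x + fy * y = 0.
  transitivity (3%:R * (x * (q0 * x ^+ 2 + q1 * x * y + q2 * y ^+ 2)
     - y * (p0 * x ^+ 2 + p1 * x * y + p2 * y ^+ 2))); first by rewrite /fx /fy; ring.
  by rewrite px qx; ring.
have g2 : fx * x' + fy * y' = 0.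
  transitivity ((q0 * x ^+ 2 + q1 * x * y + q2 * y ^+ 2) * x'
     - (p0 * x ^+ 2 + p1 * x * y + p2 * y ^+ 2) * y'
     + x * (c * y') - y * (c * x')); last by rewrite px qx; ring.
  by rewrite -dp -dq /fx /fy; ring.
have [D0|D0] := eqVneq (x * y' - x' * y) 0; last first.
  have fx0 : fx = 0.
    apply: (mulIf D0); rewrite mul0r.
    transitivity (y' * (fx * x + fy * y) - y * (fx * x' + fy * y')); first by ring.
    by rewrite g1 g2; ring.
  have fy0 : fy = 0.
    apply: (mulIf D0); rewrite mul0r.
    transitivity (x * (fx * x' + fy * y') - x' * (fx * x + fy * y)); first by ring.
    by rewrite g1 g2; ring.
  by move: f0; rewrite (res2_eq0 xy fx0 fy0) eqxx.
(* If w is proportional to z, Euler's relation gives J w = 2 c w, against J w = c w. *)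
have [k [kx ky]] : exists k, x' = k * x /\ y' = k * y.
  case/orP: (xy) => [x0|y0].
    exists (x' / x); split; first by rewrite divfK.
    apply: (mulfI x0); apply/eqP; rewrite -subr_eq0; apply/eqP.
    by rewrite -[RHS]D0; field.
  exists (y' / y); split; last by rewrite divfK.
  apply: (mulfI y0); apply/eqP; rewrite -subr_eq0; apply/eqP.
  by rewrite -[RHS]oppr0 -[in RHS]D0; field.
have k0 : k != 0.
  by apply: contraTneq xy' => k0; rewrite kx ky k0 !mul0r eqxx.
have ck : c * k != 0 by rewrite mulf_neq0.
have z1 : c * k * x = 0.
  have -> : c * k * x = (p0 * x ^+ 2 + p1 * x * y + p2 * y ^+ 2) * k * 2%:R - c * x'.
    by rewrite px kx; ring.
  by rewrite -dp kx ky; ring.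
have z2 : c * k * y = 0.
  have -> : c * k * y = (q0 * x ^+ 2 + q1 * x * y + q2 * y ^+ 2) * k * 2%:R - c * y'.
    by rewrite qx ky; ring.
  by rewrite -dq kx ky; ring.
case/orP: xy => [/negP []|/negP []].
  by move/eqP: z1; rewrite mulf_eq0 (negbTE ck).
by move/eqP: z2; rewrite mulf_eq0 (negbTE ck).
Qed.

Lemma nf_simple : fixed_simple N.
Proof.
move=> z fz; have [lz|/eqP lz] := eqVneq (lin L z) 0; first exact: nf_simple_line.
have [nz [c e]] := proj1 (fixedP _ _) fz.
have [i iz] := nf_off_line nz lz e.
rewrite /simple_fixed (proj2 (inv_proj nf_holo (nf_fixed_stdpt i) iz)).
rewrite (proj2 (nfQ_inv_stdpt s u (M_neq0 i))).
by rewrite mulf_neq0 ?invr_neq0 ?expf_neq0 //; case: ifP; rewrite ?oppr_eq0 L_neq0.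
Qed.

Lemma nf_isolated : fixed_isolated N.
Proof.
pose p := line_p M s u; pose q := line_q M s u.
(* The cubic x q - y p at y = 1, coefficients in increasing degree. *)
pose f : {poly F} := Poly [:: - p i2; q i2 - p i1; q i1 - p i0; q i0].
have [r fE] := closed_field_poly_normal f.
have [l4 s4 n4] : exists2 l4, size l4 = 4%N &
    forall i : 'I_4, nth (stdpt F j0) l4 i = stdpt F i.
  exists [seq stdpt F i | i <- enum 'I_4] => [|i]; first by rewrite size_map size_enum_ord.
  by rewrite (nth_map j0) ?size_enum_ord // nth_ord_enum.
(* The point with y = 0 is listed whether or not it is fixed, since the list need only contain the
   fixed points. With the four standard points it accounts for the offset 5 below. *)
pose l := line_pt s u 1 0 :: l4 ++ [seq line_pt s u x 1 | x <- r].
suff h z : is_fixed N z -> exists2 i, (i < size l)%N & proj_eq (nth (stdpt F j0) l i) z.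
  exists (size l), (fun i => nth (stdpt F j0) l i) => z /h[i il pz].
  by exists (Ordinal il).
move=> /fixedP[nz [c e]].
have [lz|/eqP lz] := eqVneq (lin L z) 0; last first.
  have [i iz] := nf_off_line nz lz e; exists i.+1.
    by rewrite /l /= size_cat s4 ltnS ltn_addr.
  by rewrite /l /= nth_cat s4 ltn_ord n4.
have [x [y [ez xy [zx zy]]]] := nf_line_coord lz nz.
have [] := nf_line_comp ez zx zy e; rewrite /qf2 -/p -/q => px qx.
have sc k x1 y1 : vscale k (line_pt s u x1 y1) = line_pt s u (k * x1) (k * y1).
  by rewrite /line_pt /vscale; apply: vecP => /=; ring.
have [y0|y0] := eqVneq y 0.
  rewrite y0 eqxx orbF in xy; exists 0%N => //=.
  by apply/proj_eqP; exists x => //; rewrite ez y0 sc; congr line_pt; ring.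
have fr : root f (x / y).
  rewrite /root /f horner_Poly; move: px qx; move: (p) (q) => p' q' px qx /=.
  apply/eqP; apply: (mulfI (expf_neq0 3 y0)); rewrite mulr0.
  transitivity (x * (q' i0 * x ^+ 2 + q' i1 * x * y + q' i2 * y ^+ 2)
     - y * (p' i0 * x ^+ 2 + p' i1 * x * y + p' i2 * y ^+ 2)); last by rewrite px qx; ring.
  by field.
have f0 : lead_coef f != 0.
  rewrite lead_coef_eq0; apply: contraNneq fix_neq0 => f0.
  have cf k : f`_k = 0 by rewrite f0 coef0.
  have := cf 0%N; have := cf 1%N; have := cf 2%N; have := cf 3%N.
  rewrite !coef_Poly /= /fix_cond -/p -/q => -> -> -> e0.
  have -> : p i2 = 0 by rewrite -[LHS]opprK e0 oppr0.
  by rewrite /res2; apply/eqP; ring.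
have xr : x / y \in r.
  by move: fr; rewrite fE rootZ // root_prod_XsubC.
exists (5 + index (x / y) r)%N.
  by rewrite /l /= size_cat size_map s4 !ltnS index_mem.
rewrite /l /= nth_cat s4 /= !subSS subn0 (nth_map 0) ?index_mem //.
rewrite nth_index //; apply/proj_eqP; exists y => //.
by rewrite ez sc; congr line_pt; field.
Qed.

Lemma nf_E4 : E4 L N (@stdpt F).
Proof.
split; first exact: nf_holo.
split; first exact: nf_preserves.
split; first exact: nf_isolated.
split; first exact: nf_simple.
split; first by move=> i; split; [apply: nf_fixed_stdpt|apply: stdpt_off_line].
split; first exact: stdpt_inj.
by move=> z /fixedP[nz [c e]] lz; apply: nf_off_line e.
Qed.
End NormalFormE4.

(** * General position and reduction to the normal form *)

Section GeneralPosition.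
Variable F : fieldType.
Hypothesis hF : [pchar F] =i pred0.
Implicit Types (z w a L : vec3 F) (Q : quadmap F) (p : 'I_4 -> vec3 F).

Lemma natr_eq0 n : (n%:R == 0 :> F) = (n == 0%N).
Proof. exact: (proj1 (pcharf0P F) hF). Qed.

Lemma natr_inj (m n : nat) : m%:R = n%:R :> F -> m = n.
Proof.
wlog le : m n / (m <= n)%N => [W|].
  by case: (leqP m n) => [|/ltnW] le e; [apply: W | symmetry; apply: W].
move=> e; apply/eqP; rewrite eqn_leq le /= -subn_eq0 -natr_eq0 natrB // e subrr //.
Qed.

Lemma qeval_comb Q z w x y m :
  qeval Q (vadd (vscale x z) (vscale y w)) m =
  x ^+ 2 * qeval Q z m + y ^+ 2 * qeval Q w m + x * y * mxapp (jac Q z) w m.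
Proof.
rewrite /mxapp /jac sum3 !mxE /qderiv /qeval /vadd /vscale !sum3; ring.
Qed.

Lemma proj_indep z w x y : nonzero z -> nonzero w -> ~ proj_eq z w ->
  (forall m, x * z m + y * w m = 0) -> x = 0 /\ y = 0.
Proof.
move=> nz nw nzw e.
have [y0|y0] := eqVneq y 0.
  split=> //; case: nz => i zi; apply: (mulIf zi); rewrite mul0r -[RHS](e i) y0.
  by ring.
have [x0|x0] := eqVneq x 0.
  split=> //; case: nw => i zi; apply: (mulIf zi); rewrite mul0r -[RHS](e i) x0.
  by ring.
case: nzw; apply/proj_eqP; exists (- x / y).
  by rewrite mulf_neq0 ?oppr_eq0 ?invr_eq0.
apply: vec_ext => m; apply: (mulfI y0); apply/eqP; rewrite -subr_eq0.
by rewrite -(e m) /vscale; apply/eqP; field.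
Qed.

(** In characteristic 0 the parameters 0, ..., n give n + 1 distinct points, too many for a list of
    length n. *)
Lemma pencil_not_isolated Q z w : nonzero z -> nonzero w -> ~ proj_eq z w ->
  (forall t, is_fixed Q (vadd z (vscale t w))) -> ~ fixed_isolated Q.
Proof.
move=> nz nw nzw fx [n [s iso]].
have /fin_all_exists[f fP] (t : 'I_n.+1) :
    exists i, proj_eq (s i) (vadd z (vscale (t : nat)%:R w)).
  by apply: iso; apply: fx.
suff /leq_card : injective f by rewrite !card_ord ltnn.
move=> t t' ft; apply: val_inj; apply: natr_inj => /=.
have := proj_eq_trans (proj_eq_sym (fP t)).
rewrite ft => /(_ _ (fP t')) [c [c0 e]].
have [] := @proj_indep z w (c - 1) (c * (t : nat)%:R - (t' : nat)%:R) nz nw nzw.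
  move=> m; have := e m; rewrite /vadd /vscale => /eqP; rewrite -subr_eq0 => /eqP h.
  by rewrite -[RHS]oppr0 -[in RHS]h; ring.
move=> /eqP; rewrite subr_eq0 => /eqP -> /eqP.
by rewrite mul1r subr_eq0 => /eqP.
Qed.

Lemma linD a z w : lin a (vadd z w) = lin a z + lin a w.
Proof. by rewrite /lin /vadd !sum3; ring. Qed.

Lemma linZ a c z : lin a (vscale c z) = c * lin a z.
Proof. by rewrite /lin /vscale !sum3; ring. Qed.

(* If p_k lies on the line through p_i and p_j, then f restricts to that line
   as a map with three fixed points off [a]; as f preserves [a], it then fixes
   the whole line pointwise. *)
Lemma E4_no_three_collinear a Q p i j k x y : E4 a Q p -> i <> j -> k <> i -> k <> j ->
  p k <> vadd (vscale x (p i)) (vscale y (p j)).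
Proof.
move=> [hQ [pl [iso [simp [fp [dp _]]]]]] ij ki kj e.
have nij : ~ proj_eq (p i) (p j) by move=> /dp.
have [[nzi [ci qi]] /eqP ai] : (nonzero (p i) /\ exists c, qeval Q (p i) = vscale c (p i)) /\ ~ on_line a (p i).
  by have [/fixedP h1 h2] := fp i.
have [[nzj [cj qj]] /eqP aj] : (nonzero (p j) /\ exists c, qeval Q (p j) = vscale c (p j)) /\ ~ on_line a (p j).
  by have [/fixedP h1 h2] := fp j.
have [[nzk [ck qk]] /eqP ak] : (nonzero (p k) /\ exists c, qeval Q (p k) = vscale c (p k)) /\ ~ on_line a (p k).
  by have [/fixedP h1 h2] := fp k.
have x0 : x != 0.
  apply/eqP => x0; apply: kj; apply: dp; apply: proj_eq_sym; apply/proj_eqP.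
  exists y; last by rewrite e x0; apply: vec_ext => m; rewrite /vscale /vadd; ring.
  apply/eqP => y0; apply: (proj1 (nonzeroP _) nzk); rewrite {1}e x0 y0.
  by apply: vec_ext => m; rewrite /vscale /vadd; ring.
have y0 : y != 0.
  apply/eqP => y0; apply: ki; apply: dp; apply: proj_eq_sym; apply/proj_eqP.
  exists x; first by [].
  by rewrite e y0; apply: vec_ext => m; rewrite /vscale /vadd; ring.
(* The mixed term of Q along the line; Q(p_k) = c_k p_k determines it, with coordinates [b1] and
   [b2]. *)
pose b := mxapp (jac Q (p i)) (p j).
pose b1 := (ck - x * ci) / y; pose b2 := (ck - y * cj) / x.
have bE : b = vadd (vscale b1 (p i)) (vscale b2 (p j)).
  apply: vec_ext => m; have := congr1 (fun f => f m) qk.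
  rewrite {1}e qeval_comb qi qj e -/b /vadd /vscale => h.
  have xy : x * y != 0 by rewrite mulf_neq0.
  apply: (mulfI xy); apply: (addrI (x ^+ 2 * (ci * p i m) + y ^+ 2 * (cj * p j m))).
  by rewrite h /b1 /b2; field; rewrite x0 y0.
(* Evaluate Q where the line meets [a]. Once [kap] holds, Q on the line is z times a linear form, so
   every point is fixed. *)
have kap : ck - x * ci - y * cj = 0.
  have : on_line a (vadd (vscale (lin a (p j)) (p i)) (vscale (- lin a (p i)) (p j))).
    by rewrite /on_line linD !linZ; ring.
  move=> /pl; rewrite /on_line.
  have -> : qeval Q (vadd (vscale (lin a (p j)) (p i)) (vscale (- lin a (p i)) (p j)))
    = vadd (vadd (vscale (lin a (p j) ^+ 2 * ci) (p i))
      (vscale (lin a (p i) ^+ 2 * cj) (p j))) (vscale (- (lin a (p i) * lin a (p j))) b).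
    by apply: vec_ext => m; rewrite qeval_comb qi qj -/b /vadd /vscale; ring.
  rewrite bE !(linD, linZ) /b1 /b2 => h.
  apply: (mulfI ak); apply: (mulfI ai); apply: (mulfI aj); rewrite !mulr0.
  have xy : x * y != 0 by rewrite mulf_neq0.
  rewrite e linD !linZ.
  rewrite -[RHS](mulr0 (- (x * y))) -h.
  by field; rewrite x0 y0.
have b1E : b1 = cj.
  apply: (mulIf y0); rewrite /b1 divfK //; apply/eqP; rewrite -subr_eq0.
  by rewrite -kap; apply/eqP; ring.
have b2E : b2 = ci.
  apply: (mulIf x0); rewrite /b2 divfK //; apply/eqP; rewrite -subr_eq0.
  by rewrite -kap; apply/eqP; ring.
apply: (@pencil_not_isolated Q (p i) (p j)) iso => // t.
apply/fixedP; split.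
  apply/nonzeroP => h.
  have [] := @proj_indep (p i) (p j) 1 t nzi nzj nij.
    by move=> m; have := congr1 (fun f => f m) h; rewrite /vadd /vscale mul0r mul1r.
  by move/eqP; rewrite oner_eq0.
exists (ci + t * cj); rewrite -{1}(vscale1 (p i)); apply: vec_ext => m.
by rewrite qeval_comb qi qj -/b bE b1E b2E /vadd /vscale; ring.
Qed.

Lemma E4_frame a Q p : E4 a Q p -> exists h : 'M[F]_3, h \in unitmx /\
  forall i, proj_eq (mxapp h (stdpt F i)) (p i).
Proof.
move=> E; have no := E4_no_three_collinear E.
have [_ [_ [_ [_ [fp _]]]]] := E.
pose q := mk3 (p j0) (p j1) (p j2).
(* No three collinear means that a linear relation with one zero coefficient is trivial. With b_3 =
   0 this makes the first three vectors a basis; with b_3 = -1 it makes all coordinates of the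
   fourth nonzero. *)
have key (b0 b1 b2 b3 : F) : (forall m, b0 * p j0 m + b1 * p j1 m + b2 * p j2 m + b3 * p j3 m = 0) ->
    [|| b0 == 0, b1 == 0, b2 == 0 | b3 == 0] -> [/\ b0 = 0, b1 = 0, b2 = 0 & b3 = 0].
  have three i j k (x y t : F) : i <> j -> k <> i -> k <> j ->
    (forall m, x * p i m + y * p j m + t * p k m = 0) -> t = 0.
    move=> ij ki kj e; apply/eqP/negPn/negP => t0.
    apply: (no i j k (- x / t) (- y / t)) => //; apply: vec_ext => m.
    apply: (mulfI t0); apply/eqP; rewrite -subr_eq0 -(e m) /vadd /vscale.
    by apply/eqP; field.
  have all3 i j k (x y t : F) : i <> j -> k <> i -> k <> j ->
    (forall m, x * p i m + y * p j m + t * p k m = 0) -> [/\ x = 0, y = 0 & t = 0].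
    move=> ij ki kj e; split.
    - by apply: (three j k i y t x (nesym kj) ij (nesym ki)) => m; rewrite -(e m); ring.
    - by apply: (three i k j x t y (nesym ki) (nesym ij) (nesym kj)) => m; rewrite -(e m); ring.
    - exact: (three i j k x y t).
  move=> e /or4P[] /eqP bz; rewrite bz in e *.
  - have [|||m|-> -> ->] := @all3 j1 j2 j3 b1 b2 b3 => //.
    by rewrite -(e m); ring.
  - have [|||m|-> -> ->] := @all3 j0 j2 j3 b0 b2 b3 => //.
    by rewrite -(e m); ring.
  - have [|||m|-> -> ->] := @all3 j0 j1 j3 b0 b1 b3 => //.
    by rewrite -(e m); ring.
  - have [|||m|-> -> ->] := @all3 j0 j1 j2 b0 b1 b2 => //.
    by rewrite -(e m); ring.
pose B : 'M[F]_3 := \matrix_(m, k) q k m.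
have uB : B \in unitmx.
  rewrite unitmxE unitfE -det_tr; apply/det0P => -[v v0 /rowP ev].
  case/rV0Pn: v0 => k; have [||e0 e1 e2 _] := key (v 0 i0) (v 0 i1) (v 0 i2) 0.
  - by move=> m; have := ev m; rewrite !mxE sum3 !mxE /q /= mul0r addr0.
  - by rewrite eqxx !orbT.
  - by move: k; apply: ord3P; rewrite ?(e0, e1, e2) eqxx.
pose b := mxapp (invmx B) (p j3).
have bE m : b i0 * p j0 m + b i1 * p j1 m + b i2 * p j2 m = p j3 m.
  have <- : mxapp B b m = p j3 m by rewrite /b mxappVK.
  by rewrite /mxapp sum3 !mxE /q /=; ring.
have [b0 b1 b2] : [/\ b i0 != 0, b i1 != 0 & b i2 != 0].
  have h : ~~ [|| b i0 == 0, b i1 == 0, b i2 == 0 | (-1 : F) == 0].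
    apply/negP => /(key _ _ _ (-1))[m|_ _ _].
      by rewrite bE; ring.
    by move/eqP; rewrite oppr_eq0 oner_eq0.
  by move: h; rewrite !negb_or => /and4P[].
have ub i : b i != 0 by move: i; apply: ord3P.
have hE i m : (B *m diag_mx (\row_k b k)) m i = b i * q i m.
  by rewrite mul_mx_diag !mxE mulrC.
exists (B *m diag_mx (\row_k b k)); split.
  rewrite unitmx_mul uB unitmxE det_diag unitfE /=.
  by apply/prodf_neq0 => i _; rewrite mxE.
apply: ord4P; apply: proj_eq_sym; apply/proj_eqP.
- by exists (b i0) => //; apply: vec_ext => m; rewrite mxapp_unitv hE.
- by exists (b i1) => //; apply: vec_ext => m; rewrite mxapp_unitv hE.
- by exists (b i2) => //; apply: vec_ext => m; rewrite mxapp_unitv hE.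
exists 1; rewrite ?oner_neq0 // vscale1; apply: vec_ext => m.
by rewrite /mxapp sum3 !hE /stdpt -bE /q /= !mulr1.
Qed.

Hypothesis two_neq0 : (2%:R : F) != 0.

Lemma nf_of_E4 L Q : E4 L Q (@stdpt F) -> exists M s u,
  [/\ intertwines 1%:M 1 Q (nfQ M s u),
      forall z, on_line L z <-> on_line (lvec s u) z &
      forall i, mval M i != 0].
Proof.
move=> [hQ [pl [_ [simp [fp _]]]]].
have qs i : exists2 c, c != 0 & qeval Q (stdpt F i) = vscale c (stdpt F i).
  have [/fixedP[nz [c e]] _] := fp i; exists c => //.
  exact: holo_fixed hQ nz e.
have Lnz i : mval L i != 0 by apply/eqP; have [_] := fp i.
pose M : vec3 F := fun i => Q i i i.
pose C m i j := Q m i j + Q m j i.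
have offd m i : i != m -> Q m i i = 0.
  move=> im; have [c c0 e] : exists2 c, c != 0 & qeval Q (unitv F i) = vscale c (unitv F i).
    by move: i {im}; apply: ord3P; [apply: (qs j0)|apply: (qs j1)|apply: (qs j2)].
  have := congr1 (fun f => f m) e; rewrite /vscale /unitv eq_sym (negbTE im) mulr0 => <-.
  by rewrite /qeval !sum3; move: i {im e}; apply: ord3P => /=; ring.
pose A : 'I_3 -> vec3 F :=
  mk3 (mk3 (C i0 i1 i2) (C i0 i0 i2 - M i2) (C i0 i0 i1 - M i1))
      (mk3 (C i1 i1 i2 - M i2) (C i1 i0 i2) (C i1 i0 i1 - M i0))
      (mk3 (C i2 i1 i2 - M i1) (C i2 i0 i2 - M i0) (C i2 i0 i1)).
have q01 := offd i0 i1 isT; have q02 := offd i0 i2 isT.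
have q10 := offd i1 i0 isT; have q12 := offd i1 i2 isT.
have q20 := offd i2 i0 isT; have q21 := offd i2 i1 isT.
have QE z m : qeval Q z m = z m * lin M z + A m i0 * (z i1 * z i2)
     + A m i1 * (z i0 * z i2) + A m i2 * (z i0 * z i1).
  rewrite /qeval /lin !sum3 /A /C /M; move: m; apply: ord3P => /=;
  by rewrite ?(q01, q02, q10, q12, q20, q21); ring.
clearbody A M; clear C offd q01 q02 q10 q12 q20 q21.
have [l0 l1 l2 l3] := mvalE L.
have [L0 L1 L2 L3] : [/\ L i0 != 0, L i1 != 0, L i2 != 0 & L i0 + L i1 + L i2 != 0].
  by split; [rewrite -l0|rewrite -l1|rewrite -l2|rewrite -l3].
have LQ z : lin L (qeval Q z) = lin L z * lin M z
    + (L i0 * A i0 i0 + L i1 * A i1 i0 + L i2 * A i2 i0) * (z i1 * z i2)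
    + (L i0 * A i0 i1 + L i1 * A i1 i1 + L i2 * A i2 i1) * (z i0 * z i2)
    + (L i0 * A i0 i2 + L i1 * A i1 i2 + L i2 * A i2 i2) * (z i0 * z i1).
  by rewrite {1}/lin sum3 !QE /lin !sum3; ring.
(* Each test vector on the line has a single nonzero product of two coordinates, which isolates one
   column of A. *)
have col (b : 'I_3) : L i0 * A i0 b + L i1 * A i1 b + L i2 * A i2 b = 0.
  move: b; apply: ord3P.
  - have lz : on_line L (mk3 0 (L i2) (- L i1)) by rewrite /on_line /lin sum3 /=; ring.
    have := pl _ lz; rewrite /on_line LQ lz /= => h.
    apply: (mulfI L1); apply: (mulfI L2); rewrite !mulr0 -[RHS]oppr0 -[in RHS]h; ring.
  - have lz : on_line L (mk3 (L i2) 0 (- L i0)) by rewrite /on_line /lin sum3 /=; ring.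
    have := pl _ lz; rewrite /on_line LQ lz /= => h.
    apply: (mulfI L0); apply: (mulfI L2); rewrite !mulr0 -[RHS]oppr0 -[in RHS]h; ring.
  - have lz : on_line L (mk3 (L i1) (- L i0) 0) by rewrite /on_line /lin sum3 /=; ring.
    have := pl _ lz; rewrite /on_line LQ lz /= => h.
    apply: (mulfI L0); apply: (mulfI L1); rewrite !mulr0 -[RHS]oppr0 -[in RHS]h; ring.
(* That (1,1,1) is fixed only makes the row sums equal; by [col] their common value times L_0 + L_1
   + L_2 is 0, and (1,1,1) is off the line. *)
have row m : A m i0 + A m i1 + A m i2 = 0.
  have [c c0 e] := qs j3; pose k := c - lin M (stdpt F j3).
  have rk i : A i i0 + A i i1 + A i i2 = k.
    have := congr1 (fun f => f i) e; rewrite QE /k /vscale /stdpt /= => h.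
    by rewrite -[c]mulr1 -h; ring.
  rewrite rk; apply: (mulfI L3); rewrite mulr0.
  have := col i0; have := col i1; have := col i2 => e2 e1 e0.
  transitivity (0 + 0 + 0 : F); last by ring.
  by rewrite -{1}e0 -{1}e1 -e2 !mulrDl -{1}(rk i0) -{1}(rk i1) -(rk i2); ring.
pose s : vec3 F := mk3 ((A i1 i2 + A i2 i1) / 2%:R) ((A i2 i0 + A i0 i2) / 2%:R)
  ((A i0 i1 + A i1 i0) / 2%:R).
pose u : vec3 F := mk3 ((A i1 i2 - A i2 i1) / 2%:R) ((A i2 i0 - A i0 i2) / 2%:R)
  ((A i0 i1 - A i1 i0) / 2%:R).
have AE m (b : 'I_3) : amat s u m b = A m b.
  have r0 : A i0 i0 = - A i0 i1 - A i0 i2.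
    by apply/eqP; rewrite -subr_eq0 -(row i0); apply/eqP; ring.
  have r1 : A i1 i1 = - A i1 i0 - A i1 i2.
    by apply/eqP; rewrite -subr_eq0 -(row i1); apply/eqP; ring.
  have r2 : A i2 i2 = - A i2 i0 - A i2 i1.
    by apply/eqP; rewrite -subr_eq0 -(row i2); apply/eqP; ring.
  move: m b; rewrite /amat /s /u; move: (A) r0 r1 r2 => A' r0 r1 r2.
  by apply: ord3P; apply: ord3P => /=; rewrite ?(r0, r1, r2); field.
have eQ z : qeval (nfQ M s u) z = qeval Q z.
  by apply: vec_ext => m; rewrite nfQ_eval QE /rvec !AE; ring.
have int : intertwines 1%:M 1 Q (nfQ M s u).
  by move=> z; rewrite !mxapp1 vscale1 eQ.
have Mnz i : mval M i != 0.
  have [c c0 e] := qs i; have := nfQ_stdpt M s u i; rewrite eQ e => h.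
  have [k sk] := stdpt_nonzero F i.
  have := congr1 (fun f => f k) h; rewrite /vscale => /(mulIf sk) <- //.
(* Simplicity at e_0 says that a principal minor of A is nonzero; hence A has rank 2, and its left
   kernel, which contains [L] and [lvec s u], is a line. *)
have lvec0 : lvec s u i0 != 0.
  have /(_ (stdpt F j0)) := simp; rewrite /simple_fixed.
  have [c c0 e] := qs j0.
  have [_ <-] := invariants_conj (unitmx1 _ _) (oner_neq0 _) int (proj_eq_refl _) (stdpt_nonzero F j0) c0 e.
  rewrite mxapp1 (proj2 (nfQ_inv_stdpt s u (Mnz j0))) /= => /(_ (proj1 (fp j0))).
  by have [-> _ _ _] := mvalE (lvec s u); rewrite mulf_eq0 negb_or => /andP[].
exists M, s, u; split=> // z.
have p1 : L i1 * lvec s u i0 = L i0 * lvec s u i1.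
  rewrite /lvec; have := col i1; have := col i2; rewrite -!AE => c2 c1.
  apply/eqP; rewrite -subr_eq0; apply/eqP.
  transitivity (amat s u i2 i1 * 0 - amat s u i2 i2 * 0 : F); last by ring.
  by rewrite -{1}c2 -c1 /amat /=; ring.
have p2 : L i2 * lvec s u i0 = L i0 * lvec s u i2.
  rewrite /lvec; have := col i1; have := col i2; rewrite -!AE => c2 c1.
  apply/eqP; rewrite -subr_eq0; apply/eqP.
  transitivity (amat s u i1 i2 * 0 - amat s u i1 i1 * 0 : F); last by ring.
  by rewrite -{1}c1 -c2 /amat /=; ring.
have prop : lvec s u i0 * lin L z = L i0 * lin (lvec s u) z.
  rewrite /lin !sum3 !mulrDr !mulrA ![lvec s u i0 * _]mulrC p1 p2; ring.
split; rewrite /on_line => h.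
  by apply: (mulfI L0); rewrite -prop h !mulr0.
by apply: (mulfI lvec0); rewrite prop h !mulr0.
Qed.
End GeneralPosition.

(** * Norms of polynomials along a quadratic extension *)

(* [polyfun] is sensitive to the syntactic shape of the function; [ispoly] closes
   it under extensional equality. *)
Definition ispoly (F : nzRingType) (J : Type) (f : (J -> F) -> F) :=
  exists2 g, polyfun g & g =1 f.

Section IsPoly.
Variable F : comNzRingType.
Variable J : Type.
Implicit Types f g : (J -> F) -> F.

Lemma ispoly_const (c : F) : ispoly (fun _ : J -> F => c).
Proof. by exists (fun=> c) => //; apply: pf_const. Qed.

Lemma ispoly_var (j : J) : ispoly (fun x : J -> F => x j).
Proof. by exists (fun x => x j) => //; apply: pf_var. Qed.

Lemma ispoly_add f g : ispoly f -> ispoly g -> ispoly (fun x => f x + g x).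
Proof.
move=> [f' pf ef] [g' pg eg]; exists (fun x => f' x + g' x).
  exact: pf_add.
by move=> x; rewrite ef eg.
Qed.

Lemma ispoly_mul f g : ispoly f -> ispoly g -> ispoly (fun x => f x * g x).
Proof.
move=> [f' pf ef] [g' pg eg]; exists (fun x => f' x * g' x).
  exact: pf_mul.
by move=> x; rewrite ef eg.
Qed.

Lemma ispoly_ext f g : f =1 g -> ispoly f -> ispoly g.
Proof. by move=> e [f' pf ef]; exists f' => // x; rewrite ef. Qed.

Lemma ispoly_opp f : ispoly f -> ispoly (fun x => - f x).
Proof.
move=> pf; apply: (@ispoly_ext (fun x => (-1) * f x)) => [x|].
  by rewrite mulN1r.
by apply: ispoly_mul pf; apply: ispoly_const.
Qed.

Lemma ispoly_exp f n : ispoly f -> ispoly (fun x => f x ^+ n).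
Proof.
move=> pf; elim: n => [|n IH]; first exact: ispoly_const.
apply: (@ispoly_ext (fun x => f x * f x ^+ n)) => [x|]; first by rewrite exprS.
exact: ispoly_mul.
Qed.
End IsPoly.

Definition vpoly (F : fieldType) (J : Type) (f : (J -> F) -> vec3 F) :=
  forall i, ispoly (fun x => f x i).

Ltac polytac := repeat first
  [ assumption
  | match goal with H : forall _, _ |- ispoly _ => apply: H end
  | match goal with H : vpoly _ |- ispoly _ => apply: H end
  | apply: ispoly_const
  | apply: ispoly_add
  | apply: ispoly_opp
  | apply: ispoly_mul
  | apply: ispoly_exp
  | apply: ispoly_var ].

Definition ext (F J : Type) (v : J -> F) (m : F) : option J -> F :=
  fun o => if o is Some j then v j else m.

Section Quadratic.
Variable F : closedFieldType.

Lemma quad_roots (a b c : F) : a != 0 -> exists x y,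
  [/\ b = - a * (x + y), c = a * x * y &
      forall m, (a * m ^+ 2 + b * m + c == 0) = (m == x) || (m == y)].
Proof.
move=> a0; have [x] := @solve_monicpoly F 2 (nth 0 [:: - c / a; - b / a]) isT.
rewrite !big_ord_recl big_ord0 /= addr0 expr0 mulr1 expr1 => ex.
exists x, (- b / a - x).
have bE : b = - a * (x + (- b / a - x)) by field.
have cE : c = a * x * (- b / a - x).
  transitivity (a * x * (- b / a) - a * x ^+ 2); last by ring.
  by rewrite ex; field.
split=> // m; move: (- b / a - x) bE cE => y bE cE.
rewrite -[m == x]subr_eq0 -[m == y]subr_eq0 -mulf_eq0.
rewrite -[RHS](mulrI_eq0 _ (lregP a0)).
by rewrite bE cE; congr (_ == 0); ring.
Qed.

Lemma quad_roots_distinct (a b c : F) : a != 0 -> b ^+ 2 - 4%:R * a * c != 0 ->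
  exists x y, x != y /\
  forall m, (a * m ^+ 2 + b * m + c == 0) = (m == x) || (m == y).
Proof.
move=> a0 d0; have [x [y [bE cE h]]] := quad_roots b c a0.
exists x, y; split=> //; apply: contraNneq d0 => exy.
by rewrite bE cE exy; apply/eqP; ring.
Qed.

(* On the roots m of a m^2 + b m + c, a power of [a] times a polynomial in m
   reduces to alpha + beta m, whose norm is a alpha^2 - b alpha beta + c beta^2. *)
Lemma norm_quad (J : Type) (G : (option J -> F) -> F) (a b c : (J -> F) -> F) :
  ispoly G -> ispoly a -> ispoly b -> ispoly c ->
  exists2 N, ispoly N & forall v, a v != 0 ->
    (N v != 0 <-> forall m, a v * m ^+ 2 + b v * m + c v = 0 -> G (ext v m) != 0).
Proof.
move=> [G' pG eG] pa pb pc.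
have [k [al [be [pal pbe red]]]] : exists k al be, [/\ ispoly al, ispoly be &
    forall v m, a v * m ^+ 2 + b v * m + c v = 0 ->
      a v ^+ k * G (ext v m) = al v + be v * m].
  suff [k [al [be [pal pbe red]]]] : exists k al be, [/\ ispoly al, ispoly be &
    forall v m, a v * m ^+ 2 + b v * m + c v = 0 ->
      a v ^+ k * G' (ext v m) = al v + be v * m].
    by exists k, al, be; split=> // v m h; rewrite -eG red.
  elim: {G eG} pG => [e|[j|]|f g _ [kf [af [bf [paf pbf rf]]]] _ [kg [ag [bg [pag pbg rg]]]]
                           |f g _ [kf [af [bf [paf pbf rf]]]] _ [kg [ag [bg [pag pbg rg]]]]].
  - exists 0%N, (fun=> e), (fun=> 0); split; try by polytac.
    by move=> v m _; ring.
  - exists 0%N, (fun v => v j), (fun=> 0); split; try by polytac.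
    by move=> v m _ /=; ring.
  - exists 0%N, (fun=> 0), (fun=> 1); split; try by polytac.
    by move=> v m _ /=; ring.
  - exists (kf + kg)%N, (fun v => a v ^+ kg * af v + a v ^+ kf * ag v),
      (fun v => a v ^+ kg * bf v + a v ^+ kf * bg v).
    split; try by polytac.
    move=> v m h; rewrite mulrDr exprD.
    transitivity (a v ^+ kg * (a v ^+ kf * f (ext v m)) + a v ^+ kf * (a v ^+ kg * g (ext v m))).
      by ring.
    by rewrite rf // rg //; ring.
  (* The product of two remainders has a term in m^2, and reducing it costs one more factor [a]. *)
  - exists (kf + kg).+1, (fun v => a v * af v * ag v - c v * bf v * bg v),
      (fun v => a v * (af v * bg v + bf v * ag v) - b v * bf v * bg v).
    split; try by polytac.
    move=> v m h; rewrite exprS exprD.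
    transitivity (a v * (a v ^+ kf * f (ext v m)) * (a v ^+ kg * g (ext v m))).
      by ring.
    rewrite rf // rg //; apply/eqP; rewrite -subr_eq0; apply/eqP.
    transitivity (bf v * bg v * (a v * m ^+ 2 + b v * m + c v)); first by ring.
    by rewrite h mulr0.
exists (fun v => a v * al v ^+ 2 - b v * al v * be v + c v * be v ^+ 2).
  by polytac.
move=> v a0; have [x [y [bE cE h]]] := quad_roots (b v) (c v) a0.
have -> : a v * al v ^+ 2 - b v * al v * be v + c v * be v ^+ 2 =
    a v * (al v + be v * x) * (al v + be v * y) by rewrite bE cE; ring.
have GE m : a v * m ^+ 2 + b v * m + c v = 0 ->
    (G (ext v m) != 0) = (al v + be v * m != 0).
  by move=> hm; rewrite -(red v m hm) mulf_eq0 expf_eq0 (negbTE a0) andbF.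
split=> [|H].
  rewrite !mulf_eq0 (negbTE a0) /= negb_or => /andP[nx ny] m hm; rewrite GE //.
  by move/eqP: (hm); rewrite h => /orP[/eqP ->|/eqP ->].
have hx : a v * x ^+ 2 + b v * x + c v = 0 by apply/eqP; rewrite h eqxx.
have hy : a v * y ^+ 2 + b v * y + c v = 0 by apply/eqP; rewrite h eqxx orbT.
by rewrite !mulf_neq0 // -GE // H.
Qed.
End Quadratic.

(** * Solving for the normal form *)

Section Solve.
Variable F : fieldType.
Hypothesis two_neq0 : (2%:R : F) != 0.
Implicit Types (v : 'I_4 * bool -> F) (m s c u M D : vec3 F) (X U : F).

(* t_i and d_i, see [Psi]. *)
Definition tr v i := v (i, false).
Definition dt v i := v (i, true).
Definition tau v i := tr v i - tr v j3.

(* The linear relation sum_{i<3} (t_i - t_3) M_i = 0 is parametrized by [mvec],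
   up to scaling; on it the relation sum_{i<3} d_i M_i^2 + d_3 M_3^2 = 0 becomes
   a quadratic equation in X. *)
Definition xa v := dt v j3 * (tau v j2 - tau v j0) ^+ 2
  + dt v j0 * tau v j2 ^+ 2 + dt v j2 * tau v j0 ^+ 2.
Definition xb v := 2%:R * dt v j3 * (tau v j2 - tau v j0) * (tau v j2 - tau v j1)
  + 2%:R * dt v j2 * tau v j0 * tau v j1.
Definition xc v := dt v j3 * (tau v j2 - tau v j1) ^+ 2
  + dt v j1 * tau v j2 ^+ 2 + dt v j2 * tau v j1 ^+ 2.

Definition mvec v X : vec3 F := mk3 (tau v j2 * X) (tau v j2) (- (tau v j0 * X + tau v j1)).
Definition svec v m : vec3 F :=
  mk3 (- (tr v j0 * m i0) / 2%:R) (- (tr v j1 * m i1) / 2%:R) (- (tr v j2 * m i2) / 2%:R).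
Definition dvec v m : vec3 F :=
  mk3 (dt v j0 * m i0 ^+ 2) (dt v j1 * m i1 ^+ 2) (dt v j2 * m i2 ^+ 2).
Definition e2 s := s i0 * s i1 + s i0 * s i2 + s i1 * s i2.
(** The constant terms of the three bilinear equations in [pair_eq]. *)
Definition cvec s D : vec3 F :=
  mk3 (e2 s + (D i1 + D i2) / 2%:R) (e2 s + (D i0 + D i2) / 2%:R)
      (e2 s + (D i0 + D i1) / 2%:R).

(* Eliminating u_1 and u_2 from the equations of [pair_eq] below leaves a
   quadratic equation for u_0. *)
Definition ua D := (D i1 + D i2) / 2%:R.
Definition ub s c := s i1 * c i2 - s i2 * c i1 + s i0 * (c i2 - c i1) + c i0 * (s i2 - s i1).
Definition uc s c := c i1 * c i2 - s i0 * s i2 * c i1 - s i0 * s i1 * c i2 - s i1 * s i2 * c i0.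

(* [wU] is the common denominator of u_1 and u_2 as functions of u_0 = U; the
   solution of scale [wU] is polynomial. *)
Definition wU s U := (U + s i2) * (U - s i1).
Definition uvec s c U : vec3 F :=
  mk3 (wU s U * U) ((s i2 * U - c i2) * (U - s i1)) (- (s i1 * U + c i1) * (U + s i2)).

(** Each entry of [lvec] mixes all three products u_i u_j, but a sum of two entries retains only
    one: this is what produces Moebius relations between pairs of unknowns. *)
Lemma lvec_pair s u :
  [/\ lvec s u i1 + lvec s u i2 = - (2%:R * (u i1 * u i2 + s i0 * (u i2 - u i1) + e2 s)),
      lvec s u i0 + lvec s u i2 = - (2%:R * (u i2 * u i0 + s i1 * (u i0 - u i2) + e2 s)) &
      lvec s u i0 + lvec s u i1 = - (2%:R * (u i0 * u i1 + s i2 * (u i1 - u i0) + e2 s))].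
Proof. by rewrite /lvec /amat /e2 /=; split; ring. Qed.

Lemma pair_eq D s c u : c = cvec s D ->
  (forall i, lvec s u i = D i) <->
  [/\ u i1 * u i2 + s i0 * (u i2 - u i1) + c i0 = 0,
      u i2 * u i0 + s i1 * (u i0 - u i2) + c i1 = 0 &
      u i0 * u i1 + s i2 * (u i1 - u i0) + c i2 = 0].
Proof.
move=> ->; have [p0 p1 p2] := lvec_pair s u; rewrite /cvec /=.
set x0 := _ + s i0 * _ in p0 *; set x1 := _ + s i1 * _ in p1 *; set x2 := _ + s i2 * _ in p2 *.
have q0 : x0 = - (lvec s u i1 + lvec s u i2) / 2%:R - e2 s by rewrite p0; field.
have q1 : x1 = - (lvec s u i0 + lvec s u i2) / 2%:R - e2 s by rewrite p1; field.
have q2 : x2 = - (lvec s u i0 + lvec s u i1) / 2%:R - e2 s by rewrite p2; field.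
rewrite q0 q1 q2 {p0 p1 p2 q0 q1 q2 x0 x1 x2}; move: (lvec s u) (e2 s) => L E.
split=> [h|[h0 h1 h2]]; first by rewrite !h; split; field.
have d0 : L i0 - D i0 = 0.
  transitivity (0 - 0 - 0 : F); last by ring.
  by rewrite -{1}h0 -{1}h1 -h2; field.
have d1 : L i1 - D i1 = 0.
  transitivity (0 - 0 - 0 : F); last by ring.
  by rewrite -{1}h1 -{1}h2 -h0; field.
have d2 : L i2 - D i2 = 0.
  transitivity (0 - 0 - 0 : F); last by ring.
  by rewrite -{1}h2 -{1}h0 -h1; field.
by apply: ord3P; apply/eqP; rewrite -subr_eq0 ?d0 ?d1 ?d2.
Qed.

Lemma lvecZ k s u : lvec (vscale k s) (vscale k u) = vscale (k ^+ 2) (lvec s u).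
Proof. by apply: vecP; rewrite /lvec /amat /vscale /=; ring. Qed.

Lemma uvec_sound D s c U : c = cvec s D -> wU s U != 0 ->
  ua D * U ^+ 2 + ub s c * U + uc s c = 0 ->
  lvec (vscale (wU s U) s) (uvec s c U) = vscale (wU s U ^+ 2) D.
Proof.
move=> cE w0 eU; have := w0; rewrite {1}/wU mulf_eq0 negb_or => /andP[w1 w2].
have -> : uvec s c U = vscale (wU s U) (vscale (wU s U)^-1 (uvec s c U)).
  by rewrite vscaleA mulfV // vscale1.
rewrite lvecZ; congr vscale; apply: vec_ext; apply/(pair_eq _ cE).
(* The two equations containing u_0 serve to define u_1 and u_2 and hold identically; the remaining
   one is the quadratic for U divided by [wU]. *)
rewrite /uvec /vscale /wU /=; split; last 2 first.
- by field; rewrite w1 w2.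
- by field; rewrite w1 w2.
transitivity ((ua D * U ^+ 2 + ub s c * U + uc s c) / wU s U); last first.
  by rewrite eU mul0r.
have -> : ua D = c i0 - e2 s by rewrite cE /cvec /ua /=; ring.
by rewrite /ub /uc /e2 /wU; field; rewrite w1 w2.
Qed.

(** Denominators stay cleared because [wU] is not yet known to be nonzero at a given solution. *)
Lemma uvec_complete D s c u : c = cvec s D -> (forall i, lvec s u i = D i) ->
  ua D * u i0 ^+ 2 + ub s c * u i0 + uc s c = 0 /\
  uvec s c (u i0) = vscale (wU s (u i0)) u.
Proof.
move=> cE /(pair_eq _ cE)[h0 h1 h2].
have n1 : s i2 * u i0 - c i2 = u i1 * (u i0 + s i2).
  by apply/eqP; rewrite -subr_eq0 -oppr_eq0 -h2; apply/eqP; ring.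
have n2 : - (s i1 * u i0 + c i1) = u i2 * (u i0 - s i1).
  by apply/eqP; rewrite -subr_eq0 -oppr_eq0 -h1; apply/eqP; ring.
split; last first.
  by apply: vecP; rewrite /uvec /vscale /wU /= ?n1 ?n2; ring.
have -> : ua D = c i0 - e2 s by rewrite cE /cvec /ua /=; ring.
transitivity ((s i2 * u i0 - c i2) * - (s i1 * u i0 + c i1)
   + s i0 * (- (s i1 * u i0 + c i1) * (u i0 + s i2) - (s i2 * u i0 - c i2) * (u i0 - s i1))
   + c i0 * ((u i0 + s i2) * (u i0 - s i1))).
  by rewrite /ub /uc /e2; ring.
transitivity ((u i0 + s i2) * (u i0 - s i1) *
  (u i1 * u i2 + s i0 * (u i2 - u i1) + c i0)); first by rewrite n1 n2; ring.
by rewrite h0 mulr0.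
Qed.

Definition solM v X U := let m := mvec v X in vscale (wU (svec v m) U) m.
Definition solS v X U := let s := svec v (mvec v X) in vscale (wU s U) s.
Definition solC v X := let m := mvec v X in cvec (svec v m) (dvec v m).
Definition solU v X U := uvec (svec v (mvec v X)) (solC v X) U.

Definition xroot v X := xa v * X ^+ 2 + xb v * X + xc v = 0.
Definition uroot v X U := ua (dvec v (mvec v X)) * U ^+ 2
  + ub (svec v (mvec v X)) (solC v X) * U + uc (svec v (mvec v X)) (solC v X) = 0.

Definition dsign (i : 'I_4) : F := if i == j3 then -1 else 1.

Definition nf_spec v M s u := forall i,
  tr v i * mval M i = - (2%:R * mval s i) /\
  dt v i * mval M i ^+ 2 = dsign i * mval (lvec s u) i.

Lemma xquad_mvec v X (m := mvec v X) :
  xa v * X ^+ 2 + xb v * X + xc v =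
  dt v j0 * m i0 ^+ 2 + dt v j1 * m i1 ^+ 2 + dt v j2 * m i2 ^+ 2
  + dt v j3 * (m i0 + m i1 + m i2) ^+ 2.
Proof. by rewrite /m /mvec /xa /xb /xc /=; ring. Qed.

Lemma sol_sound v X U : wU (svec v (mvec v X)) U != 0 -> xroot v X -> uroot v X U ->
  nf_spec v (solM v X U) (solS v X U) (solU v X U).
Proof.
rewrite /xroot /uroot xquad_mvec => w0 hX hU.
have lE := uvec_sound (erefl (solC v X)) w0 hU.
have tE : tr v j0 * mvec v X i0 + tr v j1 * mvec v X i1 + tr v j2 * mvec v X i2
   = tr v j3 * (mvec v X i0 + mvec v X i1 + mvec v X i2).
  by rewrite /mvec /tau /=; ring.
rewrite /nf_spec /solM /solS /solU lE.
have [a0 a1 a2 a3] := mvalE (vscale (wU (svec v (mvec v X)) U) (mvec v X)).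
have [b0 b1 b2 b3] := mvalE (vscale (wU (svec v (mvec v X)) U) (svec v (mvec v X))).
have [c0 c1 c2 c3] := mvalE (vscale (wU (svec v (mvec v X)) U ^+ 2) (dvec v (mvec v X))).
apply: ord4P; rewrite ?(a0, b0, c0) ?(a1, b1, c1) ?(a2, b2, c2) ?(a3, b3, c3) /dsign /=.
- by rewrite /vscale /svec /dvec /=; split; field.
- by rewrite /vscale /svec /dvec /=; split; field.
- by rewrite /vscale /svec /dvec /=; split; field.
rewrite /vscale; move: (wU _ _) => w; split.
  transitivity (w * (tr v j3 * (mvec v X i0 + mvec v X i1 + mvec v X i2))); first by ring.
  by rewrite -tE /svec; move: (mvec v X) => m /=; field.
apply/eqP; rewrite -subr_eq0; apply/eqP.
rewrite -[RHS](mulr0 (w ^+ 2)) -hX /dvec; move: (mvec v X) => m /=; ring.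
Qed.

(** X must be M_0 / M_1, and the second coordinate tau_2 of [mvec] fixes the scale k; then U is u_0
    / k. The condition on [wU] is discharged later by [sol_E4], once X and U are known to be roots
    at a generic v. *)
Lemma sol_complete v M s u : nf_spec v M s u -> (forall i, mval M i != 0) ->
  tau v j2 != 0 -> exists X U, [/\ xroot v X, uroot v X U &
    wU (svec v (mvec v X)) U != 0 -> exists2 k, k != 0 &
      [/\ M = vscale k (solM v X U), s = vscale k (solS v X U) & u = vscale k (solU v X U)]].
Proof.
move=> sp Mnz t2; pose k := M i1 / tau v j2; pose X := M i0 / M i1.
have [m0 m1 m2 m3] := mvalE M; have [s0 s1 s2 s3] := mvalE s.
have [l0 l1 l2 l3] := mvalE (lvec s u).
have [M0 M1] : M i0 != 0 /\ M i1 != 0 by rewrite -m0 -m1.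
have k0 : k != 0 by rewrite mulf_neq0 ?invr_eq0.
have [T0 D0] := sp j0; have [T1 D1] := sp j1; have [T2 D2] := sp j2; have [T3 D3] := sp j3.
rewrite ?(m0, s0, l0) in T0 D0; rewrite ?(m1, s1, l1) in T1 D1.
rewrite ?(m2, s2, l2) in T2 D2; rewrite ?(m3, s3, l3) in T3 D3.
rewrite /dsign /= !mul1r in D0 D1 D2; rewrite /dsign /= in D3.
have lin0 : tau v j0 * M i0 + tau v j1 * M i1 + tau v j2 * M i2 = 0.
  transitivity (tr v j0 * M i0 + tr v j1 * M i1 + tr v j2 * M i2
    - tr v j3 * (M i0 + M i1 + M i2)); first by rewrite /tau; ring.
  by rewrite T0 T1 T2 T3; ring.
have ME : M = vscale k (mvec v X).
  apply: vecP; rewrite /vscale /mvec /k /X /=.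
  - by field; rewrite M1 t2.
  - by field.
  apply: (mulfI t2); apply/eqP; rewrite -subr_eq0; apply/eqP.
  by rewrite -[RHS]lin0; field; rewrite M1 t2.
have sE : s = vscale k (svec v (mvec v X)).
  have -> : vscale k (svec v (mvec v X)) = svec v M.
    by rewrite ME; apply: vecP; rewrite /vscale /svec; move: (mvec v X) => m /=; ring.
  by apply: vecP; rewrite /svec /= ?T0 ?T1 ?T2; field.
have [u' uE] : exists u', u = vscale k u'.
  by exists (vscale k^-1 u); rewrite vscaleA mulfV // vscale1.
have lE : forall i, lvec (svec v (mvec v X)) u' i = dvec v (mvec v X) i.
  have : lvec s u = dvec v M by apply: vecP; rewrite ?D0 -?D0 -?D1 -?D2.
  rewrite sE uE lvecZ ME => h i; have := congr1 (fun f => f i) h.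
  have -> : dvec v (vscale k (mvec v X)) = vscale (k ^+ 2) (dvec v (mvec v X)).
    by apply: vecP; rewrite /vscale /dvec; move: (mvec v X) => m /=; ring.
  by rewrite /vscale; apply: mulfI; rewrite expf_neq0.
have [rU uvE] := uvec_complete (erefl (solC v X)) lE.
exists X, (u' i0); split => //.
  rewrite /xroot xquad_mvec; apply: (mulfI (expf_neq0 2 k0)); rewrite mulr0.
  transitivity (dt v j0 * M i0 ^+ 2 + dt v j1 * M i1 ^+ 2 + dt v j2 * M i2 ^+ 2
     + dt v j3 * (M i0 + M i1 + M i2) ^+ 2).
    by rewrite ME /vscale; move: (mvec v X) => m; ring.
  by rewrite D0 D1 D2 D3; ring.
move=> w0; exists (k / wU (svec v (mvec v X)) (u' i0)).
  by rewrite mulf_neq0 ?invr_eq0.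
by rewrite /solM /solS /solU uvE !vscaleA divfK // -ME -sE -uE.
Qed.

Lemma nfQZ k M s u : k != 0 ->
  intertwines 1%:M k (nfQ M s u) (nfQ (vscale k M) (vscale k s) (vscale k u)).
Proof.
move=> k0 z; rewrite !mxapp1; apply: vec_ext => m.
rewrite /vscale !nfQ_eval /rvec /lin !sum3 /amat.
by move: m; apply: ord3P => /=; ring.
Qed.

Lemma nf_spec_Psi v M s u : (forall i, mval M i != 0) ->
  nf_spec v M s u <-> (forall x, Psi (nfQ M s u) (@stdpt F) x = v x).
Proof.
move=> Mnz; split=> [sp [i b]|h i].
  have [T D] := sp i; rewrite /Psi /=; have [-> ->] := nfQ_inv_stdpt s u (Mnz i).
  case: b; apply: (mulIf (expf_neq0 2 (Mnz i))).
    by rewrite divfK ?expf_neq0 // -/(dt v i) D /dsign; case: ifP => _; ring.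
  rewrite -/(tr v i) expr2 !mulrA T divfK //; ring.
have [T D] := nfQ_inv_stdpt s u (Mnz i).
have := h (i, false); have := h (i, true); rewrite /Psi /= T D /tr /dt => <- <-.
split; first by rewrite divfK // mulr_natl.
by rewrite divfK ?expf_neq0 // /dsign; case: ifP => _; ring.
Qed.

Lemma nf_distinct M s u M' s' u' : amat s u i2 i2 != 0 ->
  (forall z, nonzero z -> proj_eq (qeval (nfQ M s u) z) (qeval (nfQ M' s' u') z)) ->
  M i0 * M' i1 = M' i0 * M i1 /\
  amat s u i1 i2 * M' i1 = amat s' u' i1 i2 * M i1.
Proof.
set A := amat s u; set A' := amat s' u' => A0 h.
(* At (1, t, 0) the third component is t A_{22}, with A_{22} nonzero, so t = 1 and t = -1 share one
   scalar c; sums and differences of the two evaluations then separate the coefficients. *)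
have cross (t : F) : let z := mk3 1 t 0 in t != 0 ->
   exists2 c, c != 0 &
     [/\ M' i0 + t * M' i1 + t * A' i0 i2 = c * (M i0 + t * M i1 + t * A i0 i2),
      M' i0 + t * M' i1 + A' i1 i2 = c * (M i0 + t * M i1 + A i1 i2) &
      A' i2 i2 = c * A i2 i2].
  move=> z t0; have [|c [c0 e]] := h z.
    by exists i0; rewrite /z /= oner_neq0.
  exists c => //; split.
  - by have := e i0; rewrite !nfQ_eval /rvec /lin !sum3 -/A -/A' /z /=;
      move=> e0; transitivity (1 * (M' i0 * 1 + M' i1 * t + M' i2 * 0) + (A' i0 i0 * (t * 0) + A' i0 i1 * (1 * 0) + A' i0 i2 * (1 * t))); [ring|rewrite e0; ring].
  - have := e i1; rewrite !nfQ_eval /rvec /lin !sum3 -/A -/A' /z /= => e1.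
    apply: (mulfI t0); transitivity (t * (M' i0 * 1 + M' i1 * t + M' i2 * 0) + (A' i1 i0 * (t * 0) + A' i1 i1 * (1 * 0) + A' i1 i2 * (1 * t))); first by ring.
    by rewrite e1; ring.
  - have := e i2; rewrite !nfQ_eval /rvec /lin !sum3 -/A -/A' /z /= => e2.
    apply: (mulfI t0); transitivity (0 * (M' i0 * 1 + M' i1 * t + M' i2 * 0) + (A' i2 i0 * (t * 0) + A' i2 i1 * (1 * 0) + A' i2 i2 * (1 * t))); first by ring.
    by rewrite e2; ring.
have [c c0 [a1 b1 d1]] := cross 1 (oner_neq0 _).
have m1 : (-1 : F) != 0 by rewrite oppr_eq0 oner_neq0.
have [c' c'0 [a2 b2 d2]] := cross (-1) m1.
have cc : c' = c by apply: (mulIf A0); rewrite -d1 -d2.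
rewrite {}cc {c' c'0 d2} in a2 b2.
have eM0 : M' i0 = c * M i0.
  apply: (mulfI two_neq0).
  transitivity ((M' i0 + 1 * M' i1 + 1 * A' i0 i2) + (M' i0 + -1 * M' i1 + -1 * A' i0 i2)); first by ring.
  by rewrite a1 a2; ring.
have eM1 : M' i1 = c * M i1.
  apply: (mulfI two_neq0).
  transitivity ((M' i0 + 1 * M' i1 + A' i1 i2) - (M' i0 + -1 * M' i1 + A' i1 i2)); first by ring.
  by rewrite b1 b2; ring.
have eA : A' i1 i2 = c * A i1 i2.
  transitivity ((M' i0 + 1 * M' i1 + A' i1 i2) - M' i0 - M' i1); first by ring.
  by rewrite b1 eM0 eM1; ring.
by rewrite eM0 eM1 eA; split; ring.
Qed.

(** X is M_0 / M_1, and A_{12} / M_1 = (s_0 + U) / tau_2 with s_0 from the unscaled [svec]: both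
    ratios survive proportionality. *)
Lemma sol_distinct v X U X' U' :
  let M := solM v X U in let M' := solM v X' U' in
  M i1 != 0 -> M' i1 != 0 -> amat (solS v X U) (solU v X U) i2 i2 != 0 ->
  (forall z, nonzero z -> proj_eq (qeval (nfQ M (solS v X U) (solU v X U)) z)
     (qeval (nfQ M' (solS v X' U') (solU v X' U')) z)) ->
  X = X' /\ U = U'.
Proof.
move=> M M' n1 n1' A0 h; have [e1 e2] := nf_distinct A0 h.
have nn : M i1 * M' i1 != 0 by rewrite mulf_neq0.
have XX : X = X'.
  apply: (mulIf nn); have M0 : M i0 = X * M i1 by rewrite /M /solM /mvec /vscale /=; ring.
  have M0' : M' i0 = X' * M' i1 by rewrite /M' /solM /mvec /vscale /=; ring.
  by rewrite mulrA -M0 e1 M0'; ring.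
split=> //; clear h A0 e1 nn; move: e2 n1 n1'; rewrite /M /M' -XX.
rewrite /solM /solS /solU /amat /uvec /vscale /=.
move: (svec _ _) => s e2; rewrite mulf_eq0 negb_or => /andP[w t].
rewrite mulf_eq0 negb_or => /andP[w' _].
apply: (addrI (s i0)); apply: (mulfI w); apply: (mulfI w'); apply: (mulfI t).
transitivity ((wU s U * s i0 + wU s U * U) * (wU s U' * mvec v X i1)); first by ring.
by rewrite e2; ring.
Qed.
End Solve.

(** * The genericity polynomial *)

Section PolyClosure.
Variable F : fieldType.
Variable K : Type.
Implicit Types (M s u c D : (K -> F) -> vec3 F) (X U k : (K -> F) -> F).
Variable V : (K -> F) -> 'I_4 * bool -> F.
Hypothesis hV : forall j, ispoly (fun x => V x j).

Lemma vpoly_scale k M : ispoly k -> vpoly M -> vpoly (fun x => vscale (k x) (M x)).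
Proof. by move=> hk hM i; rewrite /vscale; polytac. Qed.

Lemma ispoly_amat s u i j : vpoly s -> vpoly u -> ispoly (fun x => amat (s x) (u x) i j).
Proof. by move=> hs hu; move: i j; apply: ord3P; apply: ord3P; rewrite /amat /=; polytac. Qed.

Lemma vpoly_lvec s u : vpoly s -> vpoly u -> vpoly (fun x => lvec (s x) (u x)).
Proof.
move=> hs hu; have hA i j := ispoly_amat i j hs hu.
by apply: ord3P; rewrite /lvec; polytac.
Qed.

Lemma vpoly_line_p M s u : vpoly M -> vpoly s -> vpoly u ->
  vpoly (fun x => line_p (M x) (s x) (u x)).
Proof.
move=> hM hs hu; have hA i j := ispoly_amat i j hs hu; have hL := vpoly_lvec hs hu.
by apply: ord3P; rewrite /line_p; polytac.
Qed.

Lemma vpoly_line_q M s u : vpoly M -> vpoly s -> vpoly u ->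
  vpoly (fun x => line_q (M x) (s x) (u x)).
Proof.
move=> hM hs hu; have hA i j := ispoly_amat i j hs hu; have hL := vpoly_lvec hs hu.
by apply: ord3P; rewrite /line_q; polytac.
Qed.

Lemma ispoly_holo_cond M s : vpoly M -> vpoly s ->
  ispoly (fun x => holo_cond (M x) (s x)).
Proof. by move=> hM hs; rewrite /holo_cond /res2; polytac. Qed.

Lemma ispoly_fix_cond M s : vpoly M -> vpoly s ->
  ispoly (fun x => fix_cond (M x) (s x)).
Proof. by move=> hM hs; rewrite /fix_cond /res2; polytac. Qed.

Lemma ispoly_tr i : ispoly (fun x => tr (V x) i).
Proof. exact: hV. Qed.

Lemma ispoly_dt i : ispoly (fun x => dt (V x) i).
Proof. exact: hV. Qed.

Lemma ispoly_tau i : ispoly (fun x => tau (V x) i).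
Proof. by rewrite /tau; have ht := ispoly_tr; polytac. Qed.

Lemma vpoly_mvec X : ispoly X -> vpoly (fun x => mvec (V x) (X x)).
Proof.
by move=> hX; have ht := ispoly_tau; apply: ord3P; rewrite /mvec; polytac.
Qed.

Lemma vpoly_svec M : vpoly M -> vpoly (fun x => svec (V x) (M x)).
Proof.
by move=> hM; have ht := ispoly_tr; apply: ord3P; rewrite /svec; polytac.
Qed.

Lemma vpoly_dvec M : vpoly M -> vpoly (fun x => dvec (V x) (M x)).
Proof.
by move=> hM; have ht := ispoly_dt; apply: ord3P; rewrite /dvec; polytac.
Qed.

Lemma vpoly_sC X : ispoly X -> vpoly (fun x => solC (V x) (X x)).
Proof.
move=> hX; have hm := vpoly_mvec hX; have hs := vpoly_svec hm; have hd := vpoly_dvec hm.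
by apply: ord3P; rewrite /solC /cvec /e2; polytac.
Qed.

Lemma ispoly_wU s U : vpoly s -> ispoly U -> ispoly (fun x => wU (s x) (U x)).
Proof. by move=> hs hU; rewrite /wU; polytac. Qed.

Lemma vpoly_uvec s c U : vpoly s -> vpoly c -> ispoly U ->
  vpoly (fun x => uvec (s x) (c x) (U x)).
Proof.
move=> hs hc hU; have hw := ispoly_wU hs hU.
by apply: ord3P; rewrite /uvec; polytac.
Qed.

Lemma ispoly_uquad X : ispoly X ->
  [/\ ispoly (fun x => ua (dvec (V x) (mvec (V x) (X x)))),
      ispoly (fun x => ub (svec (V x) (mvec (V x) (X x))) (solC (V x) (X x))) &
      ispoly (fun x => uc (svec (V x) (mvec (V x) (X x))) (solC (V x) (X x)))].
Proof.
move=> hX; have hm := vpoly_mvec hX; have hs := vpoly_svec hm; have hd := vpoly_dvec hm.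
by have hc := vpoly_sC hX; split; rewrite /ua /ub /uc; polytac.
Qed.

Lemma ispoly_xquad :
  [/\ ispoly (fun x => xa (V x)), ispoly (fun x => xb (V x)) & ispoly (fun x => xc (V x))].
Proof.
have ht := ispoly_tau; have hd := ispoly_dt.
by split; rewrite /xa /xb /xc; polytac.
Qed.

(** A_{22} serves to tell solutions apart, the other factors to apply [nf_E4]. Since [solM] carries
    the factor [wU], nonvanishing also excludes [wU] = 0. *)
Definition gcond (v : 'I_4 * bool -> F) (X U : F) : F :=
  let M := solM v X U in let s := solS v X U in let u := solU v X U in
  amat s u i2 i2 * (M i0 * M i1 * M i2 * (M i0 + M i1 + M i2)) *
  holo_cond (line_p M s u) (line_q M s u) * fix_cond (line_p M s u) (line_q M s u).

Lemma ispoly_gcond X U : ispoly X -> ispoly U -> ispoly (fun x => gcond (V x) (X x) (U x)).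
Proof.
move=> hX hU; have hm := vpoly_mvec hX; have hs0 := vpoly_svec hm.
have hw := ispoly_wU hs0 hU; have hc := vpoly_sC hX.
have hM : vpoly (fun x => solM (V x) (X x) (U x)) := vpoly_scale hw hm.
have hs : vpoly (fun x => solS (V x) (X x) (U x)) := vpoly_scale hw hs0.
have hu : vpoly (fun x => solU (V x) (X x) (U x)) := vpoly_uvec hs0 hc hU.
have hA := ispoly_amat i2 i2 hs hu.
have hp := vpoly_line_p hM hs hu; have hq := vpoly_line_q hM hs hu.
have hh := ispoly_holo_cond hp hq; have hf := ispoly_fix_cond hp hq.
rewrite /gcond; move: hA hh hf hM => hA hh hf hM {hp hq hs hu hw hc hs0 hm}.
by polytac.
Qed.
End PolyClosure.

Section Generic.
Variable F : closedFieldType.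
Hypothesis hF : [pchar F] =i pred0.

Lemma two_neq0 : (2%:R : F) != 0.
Proof. by rewrite natr_eq0. Qed.

Definition generic (v : 'I_4 * bool -> F) :=
  [/\ tau v j2 != 0, forall i, dt v i != 0,
     exists X1 X2, X1 != X2 /\ forall X, xroot v X <-> X = X1 \/ X = X2,
     forall X, xroot v X -> exists U1 U2, U1 != U2 /\
       forall U, uroot v X U <-> U = U1 \/ U = U2 &
     forall X U, xroot v X -> uroot v X U -> gcond v X U != 0].

Lemma roots_prop (a b c : F) : a != 0 -> b ^+ 2 - 4%:R * a * c != 0 ->
  exists x y, x != y /\ forall m, a * m ^+ 2 + b * m + c = 0 <-> m = x \/ m = y.
Proof.
move=> a0 d0; have [x [y [xy h]]] := quad_roots_distinct a0 d0.
exists x, y; split=> // m; split.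
  by move=> /eqP; rewrite h => /orP[/eqP|/eqP]; [left|right].
by move=> H; apply/eqP; rewrite h; case: H => ->; rewrite eqxx ?orbT.
Qed.

(* A point where both quadratic equations have the roots 1 and -1 only. *)
Definition v0 : 'I_4 * bool -> F := fun ib =>
  match val ib.1, ib.2 with
  | 0%N, false => -1 | 3%N, false => -1 | _, false => 0
  | 3%N, true => 3%:R | _, true => -1
  end.

Lemma v0_xquad : [/\ xa v0 = 2%:R, xb v0 = 0 & xc v0 = - 2%:R].
Proof. by rewrite /xa /xb /xc /tau /tr /dt /v0 /=; split; ring. Qed.

Lemma v0_mvec X : mvec v0 X = mk3 X 1 (-1).
Proof. by apply: vecP; rewrite /mvec /tau /tr /v0 /=; ring. Qed.

Lemma v0_svec X : svec v0 (mvec v0 X) = mk3 (X / 2%:R) 0 0.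
Proof. by rewrite v0_mvec; apply: vecP; rewrite /svec /tr /v0 /=; ring. Qed.

Lemma v0_dvec X : X ^+ 2 = 1 -> dvec v0 (mvec v0 X) = mk3 (-1) (-1) (-1).
Proof. by move=> X1; rewrite v0_mvec; apply: vecP; rewrite /dvec /dt /v0 /= ?X1; ring. Qed.

Lemma v0_sC X : X ^+ 2 = 1 -> solC v0 X = mk3 (-1) (-1) (-1).
Proof.
have t := two_neq0.
by move=> X1; rewrite /solC v0_svec v0_dvec //; apply: vecP; rewrite /cvec /e2 /=; field.
Qed.

Lemma v0_uquad X : X ^+ 2 = 1 ->
  [/\ ua (dvec v0 (mvec v0 X)) = -1, ub (svec v0 (mvec v0 X)) (solC v0 X) = 0
   & uc (svec v0 (mvec v0 X)) (solC v0 X) = 1].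
Proof.
have t := two_neq0.
move=> X1; rewrite v0_sC // v0_dvec // v0_svec /ua /ub /uc /=.
by split; field.
Qed.

Lemma v0_gcond X U : X ^+ 2 = 1 -> U ^+ 2 = 1 -> gcond v0 X U != 0.
Proof.
have t := two_neq0.
move=> X1 U1; rewrite /gcond /solM /solS /solU v0_svec v0_mvec v0_sC //.
(* Here s_1 = s_2 = 0, so [wU] is U^2 and the solution needs no rescaling. *)
have -> : wU (mk3 (X / 2%:R) 0 0) U = 1 by rewrite /wU /= -U1; ring.
have -> : uvec (mk3 (X / 2%:R) 0 0) (mk3 (-1) (-1) (-1)) U = mk3 U U U.
  apply: vecP; rewrite /uvec /wU /=; [|ring|ring].
  by transitivity (U ^+ 2 * U); [ring|rewrite U1 mul1r].
rewrite !vscale1.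
have L : lvec (mk3 (X / 2%:R) 0 0) (mk3 U U U) = mk3 (-1) (-1) (-1).
  have m1 : -1 = - U ^+ 2 by rewrite U1.
  by apply: vecP; rewrite /lvec /amat /=; rewrite [RHS]m1; field.
have pE : line_p (mk3 X 1 (-1)) (mk3 (X / 2%:R) 0 0) (mk3 U U U)
    = mk3 (U - X - 1) (2%:R * U - 2%:R) 0.
  by rewrite /line_p L /amat; apply: vecP => /=; ring.
have qE : line_q (mk3 X 1 (-1)) (mk3 (X / 2%:R) 0 0) (mk3 U U U)
    = mk3 (- (X / 2%:R)) (- (2%:R * U) - 2%:R * X - 1) (- U - 2%:R).
  by rewrite /line_q L /amat; apply: vecP => /=; field.
rewrite pE qE {L pE qE}.
rewrite /holo_cond /fix_cond /res2 /amat /=.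
have R (x : F) : x ^+ 2 = 1 -> x = 1 \/ x = -1.
  by move=> /eqP; rewrite sqrf_eq1 => /orP[/eqP|/eqP]; [left|right].
(* At each of the four solutions the value is an integer, plus or minus 1215 or 675, nonzero in
   characteristic 0. *)
case: (R X X1) => ->; case: (R U U1) => ->.
- by rewrite [X in X != 0](_ : _ = - (1215%:R)) ?oppr_eq0 ?natr_eq0 //; field.
- by rewrite [X in X != 0](_ : _ = - (675%:R)) ?oppr_eq0 ?natr_eq0 //; field.
- by rewrite [X in X != 0](_ : _ = 1215%:R) ?natr_eq0 //; field.
- by rewrite [X in X != 0](_ : _ = 675%:R) ?natr_eq0 //; field.
Qed.
End Generic.

(** * Fibers *)

Section Fibers.
Variable F : closedFieldType.
Hypothesis hF : [pchar F] =i pred0.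
Let two_neq0 := two_neq0 hF.

Lemma exists_generic : exists H : ('I_4 * bool -> F) -> F,
  polyfun H /\ (exists v, H v != 0) /\ forall v, H v != 0 -> generic v.
Proof.
(* Ten variables: the eight entries of v, then X as [Some None] and U as [None]; U is eliminated
   first, then X. *)
pose V2 (x : option (option ('I_4 * bool)) -> F) j := x (Some (Some j)).
pose V1 (x : option ('I_4 * bool) -> F) j := x (Some j).
have hV2 j : ispoly (fun x => V2 x j) by apply: ispoly_var.
have hV1 j : ispoly (fun x => V1 x j) by apply: ispoly_var.
have hV0 j : ispoly (fun x : 'I_4 * bool -> F => x j) by apply: ispoly_var.
have pG : ispoly (fun x => gcond (V2 x) (x (Some None)) (x None)).
  by apply: ispoly_gcond => //; apply: ispoly_var.
have pX : ispoly (fun x : option ('I_4 * bool) -> F => x None) by apply: ispoly_var.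
have [pa pb pc] := ispoly_uquad hV1 pX.
have [NU pNU hNU] := norm_quad pG pa pb pc.
pose alU x := ua (dvec (V1 x) (mvec (V1 x) (x None))).
pose beU x := ub (svec (V1 x) (mvec (V1 x) (x None))) (solC (V1 x) (x None)).
pose gaU x := uc (svec (V1 x) (mvec (V1 x) (x None))) (solC (V1 x) (x None)).
(* The leading coefficient is included because [norm_quad] is informative only where it is nonzero,
   the discriminant because the two values of U must differ. *)
have pG1 : ispoly (fun x => alU x * (beU x ^+ 2 - 4%:R * alU x * gaU x) * NU x).
  by move: pa pb pc; rewrite -/alU -/beU -/gaU => pa pb pc; polytac.
have [qa qb qc] := ispoly_xquad hV0.
have [NX pNX hNX] := norm_quad pG1 qa qb qc.
have pH : ispoly (fun v => xa v * (xb v ^+ 2 - 4%:R * xa v * xc v) * tau v j2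
    * (dt v j0 * dt v j1 * dt v j2 * dt v j3) * NX v).
  by have ht := ispoly_tau hV0; have hd := ispoly_dt hV0; polytac.
have [H polyH HE] := pH; exists H; split=> //; split; last first.
  move=> v; rewrite HE !mulf_eq0 !negb_or -!andbA.
  move=> /and5P[a0 dX t2 d0 /and4P[d1 d2 d3 nX]].
  have {nX}G1 := proj1 (hNX v a0) nX.
  have GU X : xroot v X -> [/\ alU (ext v X) != 0,
      beU (ext v X) ^+ 2 - 4%:R * alU (ext v X) * gaU (ext v X) != 0 & NU (ext v X) != 0].
    by move=> /G1; rewrite !mulf_eq0 !negb_or => /andP[/andP[]].
  split=> //.
  - by apply: ord4P.
  - exact: roots_prop.
  - by move=> X /GU[h1 h2 _]; apply: roots_prop.
  - by move=> X U /GU[h1 _ h3] hU; apply: (proj1 (hNU (ext v X) h1) h3 U).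
exists (v0 F); rewrite HE; have [eA eB eC] := v0_xquad F.
have n2 : 2%:R != 0 :> F by apply: two_neq0.
have n3 : 3%:R != 0 :> F by rewrite natr_eq0.
have a0 : xa (v0 F) != 0 by rewrite eA.
rewrite eA eB eC !mulf_neq0 //; last first.
- apply/(hNX _ a0) => X hX; have X1 : X ^+ 2 = 1.
    move: hX; rewrite eA eB eC => hX; apply: (mulfI n2).
    by apply/eqP; rewrite -subr_eq0 -hX; apply/eqP; ring.
  have [eUA eUB eUC] := v0_uquad hF X1.
  rewrite -[alU _]/(ua (dvec (v0 F) (mvec (v0 F) X))).
  rewrite -[beU _]/(ub (svec (v0 F) (mvec (v0 F) X)) (solC (v0 F) X)).
  rewrite -[gaU _]/(uc (svec (v0 F) (mvec (v0 F) X)) (solC (v0 F) X)).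
  have aU : ua (dvec (v0 F) (mvec (v0 F) X)) != 0 by rewrite eUA oppr_eq0 oner_neq0.
  rewrite eUA eUB eUC !mulf_neq0 //.
  + by rewrite oppr_eq0 oner_neq0.
  + by rewrite [X in X != 0](_ : _ = 2%:R * 2%:R) ?mulf_neq0 //; ring.
  apply/(hNU (ext (v0 F) X) aU) => U; rewrite eUA eUB eUC => hU.
  apply: (v0_gcond hF X1); apply/eqP; rewrite -subr_eq0 -oppr_eq0 -hU.
  by apply/eqP; rewrite /=; ring.
all: rewrite /dt /tau /tr /v0 /= ?oppr_eq0 ?oner_neq0 //.
  by rewrite sub0r opprK oner_neq0.
by rewrite [X in X != 0](_ : _ = 2%:R ^+ 4) ?expf_neq0 //; ring.
Qed.

Lemma generic_solutions v : generic v -> exists X U : 'I_4 -> F,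
  [/\ forall k, xroot v (X k) /\ uroot v (X k) (U k),
      forall k l, X k = X l -> U k = U l -> k = l &
      forall x y, xroot v x -> uroot v x y -> exists k, x = X k /\ y = U k].
Proof.
move=> [_ _ [X1 [X2 [X12 hX]]] hU _].
have r1 : xroot v X1 by apply/hX; left.
have r2 : xroot v X2 by apply/hX; right.
have [U11 [U12 [n1 h1]]] := hU _ r1; have [U21 [U22 [n2 h2]]] := hU _ r2.
pose X (k : 'I_4) := if (k < 2)%N then X1 else X2.
pose U (k : 'I_4) := match val k with 0%N => U11 | 1%N => U12 | 2%N => U21 | _ => U22 end.
exists X, U; split.
- by apply: ord4P; rewrite /X /U /=; split=> //; [apply/h1; left|apply/h1; right|
    apply/h2; left|apply/h2; right].
- apply: ord4P; apply: ord4P; rewrite /X /U //= => e e';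
  by move: X12 n1 n2; rewrite ?e ?e' ?eqxx.
move=> x y /hX[->|->].
  by move=> /h1[->|->]; [exists j0|exists j1].
by move=> /h2[->|->]; [exists j2|exists j3].
Qed.

Lemma neq0_mul (x y : F) : x * y != 0 -> x != 0 /\ y != 0.
Proof. by rewrite mulf_eq0 negb_or => /andP. Qed.

Lemma sol_E4 v X U : generic v -> xroot v X -> uroot v X U ->
  [/\ wU (svec v (mvec v X)) U != 0,
      amat (solS v X U) (solU v X U) i2 i2 != 0, (forall i, mval (solM v X U) i != 0),
      E4 (lvec (solS v X U) (solU v X U)) (nfQ (solM v X U) (solS v X U) (solU v X U)) (@stdpt F) &
      forall x, Psi (nfQ (solM v X U) (solS v X U) (solU v X U)) (@stdpt F) x = v x].
Proof.
move=> [t2 d0 _ _ G] hX hU; have := G _ _ hX hU; rewrite /gcond.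
move=> /neq0_mul[/neq0_mul[/neq0_mul[A0 /neq0_mul[/neq0_mul[/neq0_mul[M0 M1] M2] M3]] ho] fi].
have w0 : wU (svec v (mvec v X)) U != 0.
  by move: M0; rewrite /solM /vscale => /neq0_mul[].
have sp := sol_sound two_neq0 w0 hX hU.
have [m0 m1 m2 m3] := mvalE (solM v X U).
have Mnz i : mval (solM v X U) i != 0.
  by move: i; apply: ord4P; rewrite ?(m0, m1, m2) // m3.
split=> //; last exact: (proj1 (nf_spec_Psi _ _ _ Mnz) sp).
(* d_i M_i^2 equals L_i up to sign, so d_i nonzero puts the standard points off the line. *)
apply: nf_E4 => // i; have [_ D] := sp i.
have : dsign F i * mval (lvec (solS v X U) (solU v X U)) i != 0.
  by rewrite -D mulf_neq0 ?expf_neq0.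
by rewrite mulf_eq0 negb_or => /andP[].
Qed.
End Fibers.

(** * Transitivity on lines and rigidity of projective frames *)

Section Frames.
Variable F : fieldType.
Implicit Types (a L z : vec3 F) (Q : quadmap F) (g h : 'M[F]_3).

Lemma lin_mxapp a g z : lin a (mxapp g z) = lin (fun j => \sum_(m < 3) a m * g m j) z.
Proof. by rewrite /lin /mxapp !sum3; ring. Qed.

Lemma linZl a c z : lin (vscale c a) z = c * lin a z.
Proof. by rewrite /lin /vscale !sum3; ring. Qed.

(** The rank normal form writes any nonzero row as a multiple of (1, 0, 0) times an invertible
    matrix; comparing both rows gives [g]. *)
Lemma move_line a L : nonzero a -> nonzero L -> exists2 g, g \in unitmx &
  forall z, on_line L z <-> on_line a (mxapp g z).
Proof.
have base (b : vec3 F) : nonzero b -> exists c (g : 'M[F]_3),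
    [/\ c != 0, g \in unitmx & \row_j b j = c *: (pid_mx 1 *m g)].
  move=> [i bi]; pose r := \row_j b j.
  have r0 : r != 0 by apply/rV0Pn; exists i; rewrite mxE.
  exists (col_ebase r 0 0), (row_ebase r); split; last 2 first.
  - exact: row_ebase_unit.
  - rewrite -/r -[LHS]mulmx_ebase rank_rV r0.
    by rewrite [col_ebase r]mx11_scalar mul_scalar_mx -scalemxAl mxE eqxx mulr1n.
  have := col_ebase_unit r; rewrite [col_ebase r]mx11_scalar unitmxE det_scalar1 unitfE.
  by rewrite mxE eqxx mulr1n.
move=> /base[c [g [c0 ug ea]]] /base[d [h [d0 uh eL]]].
exists (invmx g *m h); first by rewrite unitmx_mul unitmx_inv ug.
have e : (\row_j a j) *m (invmx g *m h) = (c / d) *: \row_j L j.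
  rewrite ea eL scalerA divfK // -scalemxAl -mulmxA [g *m _]mulmxA mulmxV // mul1mx //.
move=> z; rewrite /on_line lin_mxapp.
have -> : (fun j => \sum_(m < 3) a m * (invmx g *m h) m j) = vscale (c / d) L.
  apply: vec_ext => j; have /rowP/(_ j) := e; rewrite mxE ![in RHS]mxE /vscale => <-.
  by apply: eq_bigr => m _; rewrite [in RHS]mxE.
rewrite linZl; split=> [->|/eqP]; first by rewrite mulr0.
by rewrite !mulf_eq0 invr_eq0 (negbTE c0) (negbTE d0) => /eqP.
Qed.

(** The first three points make [h] diagonal, the fourth makes its diagonal entries equal. *)
Lemma frame_scalar h : (forall i, proj_eq (mxapp h (stdpt F i)) (stdpt F i)) ->
  exists2 c, c != 0 & forall z, mxapp h z = vscale c z.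
Proof.
move=> fr; have fr' i : exists2 c, c != 0 & mxapp h (stdpt F i) = vscale c (stdpt F i).
  by apply/proj_eqP; apply: proj_eq_sym.
have [c0 n0 e0] := fr' j0; have [c1 n1 e1] := fr' j1; have [c2 n2 e2] := fr' j2.
have [c n e] := fr' j3.
have hE l (k : F) : mxapp h (unitv F l) = vscale k (unitv F l) ->
   forall i, h i l = k * (i == l)%:R.
  by move=> el i; rewrite -mxapp_unitv el.
have {}e0 := hE i0 c0 e0; have {}e1 := hE i1 c1 e1; have {}e2 := hE i2 c2 e2.
have hc i : h i i0 + h i i1 + h i i2 = c.
  by have := congr1 (fun f => f i) e; rewrite /mxapp sum3 /stdpt /vscale /= !mulr1.
have E0 : c0 = c by rewrite -(hc i0) e0 e1 e2 /=; ring.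
have E1 : c1 = c by rewrite -(hc i1) e0 e1 e2 /=; ring.
have E2 : c2 = c by rewrite -(hc i2) e0 e1 e2 /=; ring.
exists c => // z; apply: vecP; rewrite /mxapp sum3 !(e0, e1, e2) E0 E1 E2 /vscale /=; ring.
Qed.

Lemma intertwines_comp g h k l Q Q' Q'' : intertwines g k Q Q' ->
  intertwines h l Q' Q'' -> intertwines (h *m g) (l * k) Q Q''.
Proof. by move=> e e' z; rewrite !mxapp_mul e' e mxappZ vscaleA. Qed.

Lemma conj_rel_intro a g k Q p Q' p' : g \in unitmx -> k != 0 ->
  intertwines g k Q Q' -> (forall z, on_line a z -> on_line a (mxapp g z)) ->
  (forall i, proj_eq (mxapp g (p i)) (p' i)) -> conj_rel a Q p Q' p'.
Proof.
move=> ug k0 e la pp; exists g; split=> //; split=> // z _.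
by apply/proj_eqP; exists k => //; rewrite -e mxappVK.
Qed.
End Frames.

Theorem theorem3 (F : closedFieldType) (hF : [pchar F] =i pred0)
    (a : vec3 F) (ha : nonzero a) :
  exists H : ('I_4 * bool -> F) -> F,
    polyfun H /\ (exists v, H v != 0) /\
    forall v, H v != 0 ->
      exists (Q : 'I_4 -> quadmap F) (p : 'I_4 -> 'I_4 -> vec3 F),
        (forall k, E4 a (Q k) (p k) /\ forall x, Psi (Q k) (p k) x = v x) /\
        (forall k l, conj_rel a (Q k) (p k) (Q l) (p l) -> k = l) /\
        (forall (Q' : quadmap F) (p' : 'I_4 -> vec3 F),
           E4 a Q' p' -> (forall x, Psi Q' p' x = v x) ->
           exists k, conj_rel a (Q k) (p k) Q' p').
Proof.
have t2 := two_neq0 hF.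
have [H [polyH [nzH genH]]] := exists_generic hF.
exists H; split=> //; split=> // v /genH gv.
have [X [U [rt inj cov]]] := generic_solutions gv.
pose M k := solM v (X k) (U k); pose s k := solS v (X k) (U k); pose u k := solU v (X k) (U k).
pose L k := lvec (s k) (u k); pose N k := nfQ (M k) (s k) (u k).
have sol k := sol_E4 hF gv (proj1 (rt k)) (proj2 (rt k)).
have /fin_all_exists[g gP] k : exists g : 'M[F]_3, g \in unitmx /\
    forall z, on_line (L k) z <-> on_line a (mxapp g z).
  have [] := @move_line F a (L k) ha; last by move=> g ug gl; exists g.
  have [_ _ _ [_ [_ [_ [_ [fp _]]]]] _] := sol k.
  have [_ off] := fp j0; apply/nonzeroP => e; apply: off; rewrite /on_line -/(L k) e.
  by rewrite /lin /vscale !sum3; ring.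
have ug k : g k \in unitmx by have [] := gP k.
have gl k z : on_line (L k) z <-> on_line a (mxapp (g k) z) by have [_] := gP k; apply.
pose Q k := conjQ (g k) (N k); pose p k i := mxapp (g k) (stdpt F i).
have iQ k : intertwines (g k) 1 (N k) (Q k) := intertwines_conjQ (N k) (ug k).
have Nsol k : E4 (L k) (N k) (@stdpt F) /\ forall x, Psi (N k) (@stdpt F) x = v x.
  by have [_ _ _ ? ?] := sol k.
exists Q, p; split; [|split].
- move=> k; have [EN PN] := Nsol k.
  have [EQ PQ] := E4_transport (p' := p k) (ug k) (oner_neq0 _) (iQ k) (gl k)
    (fun i => proj_eq_refl _) EN.
  by split=> // x; rewrite PQ PN.
- move=> k l [h [[uh _] [sm pp]]].
  pose h' := invmx (g l) *m (h *m g k).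
  have h'E z : mxapp h (mxapp (g k) z) = mxapp (g l) (mxapp h' z).
    by rewrite /h' !mxapp_mul mxappVK.
  (* As [h] respects the markings, [h'] fixes the standard frame and is scalar; the two normal forms
     thus define the same projective map. *)
  have [c c0 hc] : exists2 c, c != 0 & forall z, mxapp h' z = vscale c z.
    by apply: frame_scalar => i; apply: (proj_eq_mxappI (ug l)); rewrite -h'E; apply: pp.
  have NN z : nonzero z -> proj_eq (qeval (N k) z) (qeval (N l) z).
    move=> nz; apply: (proj_eq_mxappI (ug l)).
    have nz' : nonzero (mxapp h (mxapp (g k) z)) by do 2! apply: nonzero_mxapp => //.
    have := sm _ nz'; rewrite mxappK // iQ vscale1 !h'E !hc.
    rewrite iQ vscale1 qevalZ !mxappZ => pe.
    apply: proj_eq_trans (_ : proj_eq _ (vscale c (mxapp (g l) (qeval (N k) z)))) _.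
      by apply/proj_eqP; exists c.
    apply: proj_eq_trans pe _; apply: proj_eq_sym; apply/proj_eqP; exists (c ^+ 2) => //.
    exact: expf_neq0.
  have [_ A0 Mk _ _] := sol k; have [_ _ Ml _ _] := sol l.
  have [_ m1 _ _] := mvalE (M k); have [_ m1' _ _] := mvalE (M l).
  have [||XX UU] := sol_distinct t2 _ _ A0 NN; [by move: (Mk j1); rewrite m1|by move: (Ml j1); rewrite m1'|].
  exact: inj.
move=> Q' p' E' P'.
have [h [uh hp]] := E4_frame hF E'.
have uh' : invmx h \in unitmx by rewrite unitmx_inv.
(* The equation of [a] read in the frame [h]. *)
pose L' j := \sum_(m < 3) a m * h m j.
have iQ' := intertwines_conjQ Q' uh'.
have hl z : on_line a z <-> on_line L' (mxapp (invmx h) z).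
  by rewrite /on_line -lin_mxapp mxappVK.
have hp' i : proj_eq (mxapp (invmx h) (p' i)) (stdpt F i).
  by apply: (proj_eq_mxappI uh); rewrite mxappVK //; apply: proj_eq_sym.
have [E'' P''] := E4_transport uh' (oner_neq0 _) iQ' hl hp' E'.
have [M' [s' [u' [i1' l1 Mnz]]]] := nf_of_E4 t2 E''.
have l1' z : on_line L' z <-> on_line (lvec s' u') (mxapp 1%:M z) by rewrite mxapp1.
have pt1 i : proj_eq (mxapp 1%:M (stdpt F i)) (stdpt F i).
  by rewrite mxapp1; apply: proj_eq_refl.
have [_ P3] := E4_transport (unitmx1 _ _) (oner_neq0 _) i1' l1' pt1 E''.
have sp : nf_spec v M' s' u'.
  by apply/(nf_spec_Psi _ _ _ Mnz) => x; rewrite P3 P'' P'.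
have [tau0 _ _ _ _] := gv.
have [x [y [rx ry kE]]] := sol_complete t2 sp Mnz tau0.
have [k [xE yE]] := cov x y rx ry; exists k; rewrite xE yE in kE.
have [w0 _ _ _ _] := sol k; have [c c0 [ME sE uE]] := kE w0.
have LE : lvec s' u' = vscale (c ^+ 2) (L k) by rewrite sE uE lvecZ.
have iN : intertwines 1%:M c (N k) (nfQ M' s' u') by rewrite ME sE uE; apply: nfQZ.
have ug' : invmx (g k) \in unitmx by rewrite unitmx_inv.
have c1 := oner_neq0 F.
(* From [Q k] to [N k], to its rescaling by [c], to [Q'] read in the frame [h], and back to [Q']. *)
have chain := intertwines_comp (intertwines_comp (intertwines_comp
   (intertwines_inv (ug k) c1 (iQ k)) iN) (intertwines_inv (unitmx1 _ _) c1 i1'))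
   (intertwines_inv uh' c1 iQ').
rewrite invmxK invmx1 !mul1mx in chain.
apply: (conj_rel_intro _ _ chain).
- by rewrite unitmx_mul uh ug'.
- by rewrite !mulf_neq0 ?invr_eq0.
(* The line goes from [a] to [L k], which is proportional to [lvec s' u'] by [LE], hence to [L'] and
   back to [a]. *)
- move=> z; rewrite mxapp_mul -{1}(mxappVK z (ug k)) => /gl; set z' := mxapp _ z => lz.
  apply/hl; rewrite mxappK //; apply/l1.
  by rewrite LE /on_line linZl lz mulr0.
move=> i; rewrite /p mxapp_mul mxappK //; exact: hp.
Qed.
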